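(* Let $X$ be a smooth manifold. In both symmetric monoidal bicategories $\mathrm{Grpd}(\mathrm{sAlgBdl}^{\mathrm{bi}}_k(X))$ and $\mathrm{ss\text{-}sAlgBdl}^{\mathrm{bi}}_k(X)$, an object (a super algebra bundle over $X$) is invertible with respect to the tensor product if and only if it is fibrewise invertible, i.e., if and only if all its fibres are central simple super algebras.
   Context: Let $k=\mathbb{R}$ or $k=\mathbb{C}$. A super algebra is a finite-dimensional, $\mathbb{Z}_2$-graded, unital, associative $k$-algebra; super algebra homomorphisms are even unital algebra homomorphisms, $\mathrm{Aut}(A)$ is the Lie group of even automorphisms. A super algebra $A$ is simple if $1\neq0$ and its only graded two-sided ideals are $\{0\}$ and $A$; semisimple if it is a direct sum of simple super algebras; central if the even part of its (ungraded) center is $k\cdot 1$. Bimodules are finite-dimensional and $\mathbb{Z}_2$-graded; intertwiners are even. The invertible objects of the symmetric monoidal bicategory of super algebras, bimodules and intertwiners (under graded tensor product) are known to be precisely the central simple super algebras. Implementing bimodules: for an $A$-$B$-bimodule $M$, $I(M)$ is the Lie group of triples $(\phi,u,\psi)$ with $\phi\in\mathrm{Aut}(A)$, $\psi\in\mathrm{Aut}(B)$ and $u:M\to M$ an even invertible linear map with $u(a\triangleright m\triangleleft b)=\phi(a)\triangleright u(m)\triangleleft\psi(b)$. $M$ is implementing if both projections $I(M)\to\mathrm{Aut}(A)$ and $I(M)\to\mathrm{Aut}(B)$ are open maps. Bundles: a super algebra bundle over $X$ is a smooth vector bundle $\mathcal{A}\to X$ with a super algebra structure on each fibre that is locally isomorphic,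 fibrewise as super algebras, to $U\times A$ for super algebras $A$. An $\mathcal{A}$-$\mathcal{B}$-bimodule bundle is a smooth super vector bundle $\mathcal{M}$ with $\mathcal{A}_x$-$\mathcal{B}_x$-bimodule structures on the fibres such that around every point there are local trivializations $\phi:\mathcal{A}|_U\to U\times A$, $\psi:\mathcal{B}|_U\to U\times B$ of super algebra bundles, an $A$-$B$-bimodule $M$, and a super vector bundle trivialization $u:\mathcal{M}|_U\to U\times M$ with $u(a\triangleright m\triangleleft b)=\phi(a)\triangleright u(m)\triangleleft\psi(b)$ fibrewise. It is implementing if all its fibres are implementing. The bicategory $\mathrm{sAlgBdl}^{\mathrm{bi}}_k(X)$ has super algebra bundles over $X$ as objects, implementing bimodule bundles as 1-morphisms (an $\mathcal{A}$-$\mathcal{B}$-bimodule bundle being a 1-morphism $\mathcal{B}\to\mathcal{A}$), even fibrewise intertwining smooth bundle morphisms as 2-morphisms, and composition given by the fibrewise relative tensor product with the unique vector bundle structure making $\mathcal{M}\otimes\mathcal{N}\to\mathcal{M}\otimes_{\mathcal{B}}\mathcal{N}$ smooth. $\mathrm{Grpd}(\mathrm{sAlgBdl}^{\mathrm{bi}}_k(X))$ is the sub-bigroupoid with all objects, invertible 1-morphisms and invertible 2-morphisms; $\mathrm{ss\text{-}sAlgBdl}^{\mathrm{bi}}_k(X)$ is the full sub-bicategory over super algebra bundles with semisimple fibres. Both are symmetric monoidal under the fibrewise graded tensor product (and the exterior graded tensor product of bimodule bundles over $k$), with tensor unit the trivial bundle $X\times k$. An object $\mathcal{A}$ is invertible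 if there is an object $\mathcal{A}'$ with $\mathcal{A}\otimes\mathcal{A}'$ isomorphic (equivalent) in the bicategory to the tensor unit. *)

(* Defs.v *)
Set Warnings "-notation-overridden,-ambiguous-paths".
Set Warnings "-notation-incompatible-prefix".
From HB Require Import structures.
From mathcomp Require Import all_boot all_order all_algebra.
From mathcomp Require Import complex.
From mathcomp Require Import all_classical all_reals all_analysis.

Set Implicit Arguments.
Unset Strict Implicit.
Unset Printing Implicit Defensive.

Import Order.TTheory GRing.Theory Num.Theory.
Import numFieldNormedType.Exports.

Local Open Scope classical_set_scope.
Local Open Scope ring_scope.

(** * Super vector spaces, super algebras and bimodules over a field

   Gradings are indexed by [bool] ([false] even, [true] odd), so that degrees
   add with [addb].  Bilinear maps are elements of ['Hom(U, 'Hom(V, W))]. *)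

Section SuperAlgebra.
Variable K : fieldType.

Record svect := SVect {
  svect_sort :> vectType K;
  part : bool -> {vspace svect_sort};
  part_sum : (part false + part true = fullv)%VS;
  part_cap : (part false :&: part true = 0)%VS }.

Definition even_map (V W : svect) (f : 'Hom(V, W)) : Prop :=
  forall i v, v \in part V i -> f v \in part W i.

Definition even_bilin (U V W : svect) (b : 'Hom(U, 'Hom(V, W))) : Prop :=
  forall i j u v, u \in part U i -> v \in part V j ->
    b u v \in part W (i (+) j).

(* The library's [falgType]/[algType] exclude the zero algebra, which is a
   legitimate super algebra; hence this record. *)
Record salg := SAlg {
  salg_vect :> svect;
  smul : 'Hom(salg_vect, 'Hom(salg_vect, salg_vect));
  sone : salg_vect;
  smulA : forall a b c, smul a (smul b c) = smul (smul a b) c;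
  smul1l : forall a, smul sone a = a;
  smul1r : forall a, smul a sone = a;
  smul_even : even_bilin smul;
  sone_even : sone \in part salg_vect false }.

Definition salg_hom (A B : salg) (f : 'Hom(A, B)) : Prop :=
  [/\ even_map f, f (sone A) = sone B
    & forall a b, f (smul A a b) = smul B (f a) (f b)].

Definition salg_aut (A : salg) (f : 'End(A)) : Prop :=
  salg_hom f /\ bijective f.

(* A two-sided ideal of a unital algebra is automatically a subspace. *)
Definition graded_ideal (A : salg) (I : {vspace A}) : Prop :=
  [/\ forall a x, x \in I -> smul A a x \in I,
      forall a x, x \in I -> smul A x a \in I
    & (I = (I :&: part A false) + (I :&: part A true))%VS].

Definition simple_salg (A : salg) : Prop :=
  sone A <> 0 /\ forall I : {vspace A}, @graded_ideal A I -> I = 0%VS \/ I = fullv.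

(* [p] exhibits [A] as the direct sum (product) of the [B i]; the empty family
   is allowed and gives the zero algebra. *)
Definition semisimple_salg (A : salg) : Prop :=
  exists (m : nat) (B : 'I_m -> salg) (p : forall i, 'Hom(A, B i)),
    [/\ forall i, simple_salg (B i), forall i, salg_hom (p i)
      & forall b : forall i, B i, exists! a, forall i, p i a = b i].

Definition central_salg (A : salg) : Prop :=
  forall z : A,
    (z \in part A false /\ forall a, smul A z a = smul A a z) <->
    exists c : K, z = c *: sone A.

Definition central_simple (A : salg) : Prop :=
  central_salg A /\ simple_salg A.

Record sbimod (A B : salg) := SBimod {
  sbimod_vect :> svect;
  lact : 'Hom(A, 'Hom(sbimod_vect, sbimod_vect));
  ract : 'Hom(sbimod_vect, 'Hom(B, sbimod_vect));
  lact1 : forall m, lact (sone A) m = m;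
  lactM : forall a a' m, lact (smul A a a') m = lact a (lact a' m);
  ract1 : forall m, ract m (sone B) = m;
  ractM : forall m b b', ract m (smul B b b') = ract (ract m b) b';
  lractA : forall a m b, lact a (ract m b) = ract (lact a m) b;
  lact_even : even_bilin lact;
  ract_even : even_bilin ract }.

Definition intertwiner (A B : salg) (M N : sbimod A B) (f : 'Hom(M, N)) : Prop :=
  [/\ even_map f, forall a m, f (lact M a m) = lact N a (f m)
    & forall m b, f (ract M m b) = ract N (f m) b].

Definition sbimod_iso (A B : salg) (M N : sbimod A B) : Prop :=
  exists f : 'Hom(M, N), intertwiner f /\ bijective f.

Definition regular_sbimod (A : salg) : sbimod A A :=
  @SBimod A A A (smul A) (smul A) (@smul1l A)
    (fun a a' m => esym (smulA a a' m)) (@smul1r A) (@smulA A) (@smulA A)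
    (@smul_even A) (@smul_even A).

(* [(T, t)] is the graded tensor product of [A] and [B]: [t] is the universal
   bilinear map, and the product follows the Koszul sign rule. *)
Definition is_graded_tensor (A B T : salg) (t : 'Hom(A, 'Hom(B, T))) : Prop :=
  [/\ even_bilin t,
      t (sone A) (sone B) = sone T,
      forall i j a b a' b', b \in part B i -> a' \in part A j ->
        smul T (t a b) (t a' b') =
          (-1) ^+ (i && j) *: t (smul A a a') (smul B b b')
    & forall (W : vectType K) (s : 'Hom(A, 'Hom(B, W))),
        exists! f : 'Hom(T, W), forall a b, f (t a b) = s a b].

Definition balanced (A B C : salg) (M : sbimod A B) (N : sbimod B C)
    (W : vectType K) (t : 'Hom(M, 'Hom(N, W))) : Prop :=
  forall m b n, t (ract M m b) n = t m (lact N b n).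

(* [(P, t)] is the relative tensor product of [M] and [N] over [B]. *)
Definition is_rel_tensor (A B C : salg) (M : sbimod A B) (N : sbimod B C)
    (P : sbimod A C) (t : 'Hom(M, 'Hom(N, P))) : Prop :=
  [/\ balanced t, even_bilin t,
      forall a m n, t (lact M a m) n = lact P a (t m n),
      forall m n c, t m (ract N n c) = ract P (t m n) c
    & forall (W : vectType K) (s : 'Hom(M, 'Hom(N, W))), balanced s ->
        exists! f : 'Hom(P, W), forall m n, f (t m n) = s m n].

(* Equivalence and invertibility in the bicategory of super algebras,
   bimodules and intertwiners. *)
Definition salg_equivalent (A B : salg) : Prop :=
  exists (M : sbimod A B) (N : sbimod B A),
    (exists (P : sbimod A A) (t : 'Hom(M, 'Hom(N, P))),
        is_rel_tensor t /\ sbimod_iso P (regular_sbimod A)) /\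
    (exists (Q : sbimod B B) (t : 'Hom(N, 'Hom(M, Q))),
        is_rel_tensor t /\ sbimod_iso Q (regular_sbimod B)).

Lemma ground_part_sum : ((fullv : {vspace K^o}) + 0 = fullv)%VS.
Proof. exact: addv0. Qed.

Lemma ground_part_cap : ((fullv : {vspace K^o}) :&: 0 = 0)%VS.
Proof. exact: capv0. Qed.

Definition ground_svect : svect :=
  @SVect K^o (fun i => if i then 0%VS else fullv)
    ground_part_sum ground_part_cap.

Definition ground_mulf (a : ground_svect) : 'End(ground_svect) :=
  (a : K) *: \1%VF.

Lemma ground_mulf_is_linear : linear ground_mulf.
Proof. by move=> c u v; rewrite /ground_mulf scalerDl -scalerA. Qed.

HB.instance Definition _ :=
  GRing.isLinear.Build K ground_svect 'End(ground_svect) _ ground_mulf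
    ground_mulf_is_linear.

Definition ground_mul : 'Hom(ground_svect, 'End(ground_svect)) :=
  linfun ground_mulf.

Lemma ground_mulE (a b : ground_svect) : ground_mul a b = (a : K) * (b : K).
Proof. by rewrite lfunE /= scale_lfunE id_lfunE. Qed.

Fact ground_mulA a b c :
  ground_mul a (ground_mul b c) = ground_mul (ground_mul a b) c.
Proof. by rewrite !ground_mulE mulrA. Qed.

Fact ground_mul1l a : ground_mul (1 : K) a = a.
Proof. by rewrite ground_mulE mul1r. Qed.

Fact ground_mul1r a : ground_mul a (1 : K) = a.
Proof. by rewrite ground_mulE mulr1. Qed.

Fact ground_mul_even : even_bilin ground_mul.
Proof.
move=> [] [] u v /=; rewrite ?memvf // !memv0 ground_mulE.
- by move=> /eqP -> _; rewrite mul0r.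
- by move=> _ /eqP ->; rewrite mulr0.
Qed.

Fact ground_one_even : (1 : K) \in part ground_svect false.
Proof. exact: memvf. Qed.

(* The ground field, concentrated in even degree. *)
Definition ground_salg : salg :=
  SAlg ground_mulA ground_mul1l ground_mul1r ground_mul_even ground_one_even.

Definition invertible_salg (A : salg) : Prop :=
  exists (A' T : salg) (t : 'Hom(A, 'Hom(A', T))),
    is_graded_tensor t /\ salg_equivalent T ground_salg.

End SuperAlgebra.

(** * Topology on spaces of linear maps; implementing bimodules *)

Section Implementing.
Variable K : numFieldType.

Definition lfun_mx (V W : vectType K) (f : 'Hom(V, W)) :
    'M[K]_(\dim (fullv : {vspace V}), \dim (fullv : {vspace W})) :=
  \matrix_(i, j) coord (vbasis fullv) j (f (tnth (vbasis fullv) i)).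

(* ['Hom(V, W)] with its vector space topology. *)
Definition lfun_top (V W : vectType K) : topologicalType :=
  initial_topology (@lfun_mx V W).

Definition open_map (S T : topologicalType) (f : S -> T) : Prop :=
  forall U, open U -> open (f @` U).

(* [Aut(A)] and [I(M)] are sets in spaces of linear maps; coerced to types they
   carry the subspace topology, which is that of the closed Lie subgroups. *)
Definition AutS (A : salg K) : set (lfun_top A A) := [set f | salg_aut f].

Definition ImplS (A B : salg K) (M : sbimod A B) :
    set (lfun_top A A * lfun_top M M * lfun_top B B)%type :=
  [set t | let phi : 'End(A) := t.1.1 in
           let u : 'End(M) := t.1.2 in
           let psi : 'End(B) := t.2 in
    [/\ salg_aut phi, salg_aut psi, even_map u, bijective u
      & forall a m b, u (ract M (lact M a m) b) =
                      ract M (lact M (phi a) (u m)) (psi b)]].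

Arguments AutS : clear implicits.
Arguments ImplS {A B} M.

Section Projections.
Variables (A B : salg K) (M : sbimod A B).

Fact ImplS_autl (t : ImplS M) : (set_val t).1.1 \in AutS A.
Proof. by apply/mem_set; case: (set_mem (valP t)). Qed.

Fact ImplS_autr (t : ImplS M) : (set_val t).2 \in AutS B.
Proof. by apply/mem_set; case: (set_mem (valP t)). Qed.

Definition impl_projl (t : ImplS M) : AutS A := SigSub (ImplS_autl t).
Definition impl_projr (t : ImplS M) : AutS B := SigSub (ImplS_autr t).

Definition implementing_sbimod : Prop :=
  open_map impl_projl /\ open_map impl_projr.

End Projections.
End Implementing.

(** * Smooth manifolds *)

Section Manifold.
Variable R : realType.

Definition basis_vec n (i : 'I_n) : 'rV[R]_n := delta_mx 0 i.

(* [f] is of class C^k on the open set [D]. *)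
Fixpoint Ck (k n : nat) (D : set 'rV[R]_n) (f : 'rV[R]_n -> R) : Prop :=
  (forall x, D x -> {for x, continuous f}) /\
  if k is k'.+1 then
    forall i : 'I_n, (forall x, D x -> derivable f x (basis_vec i)) /\
      Ck k' D (fun x => 'D_(basis_vec i) f x)
  else True.

Definition Cinfty (n : nat) (D : set 'rV[R]_n) (f : 'rV[R]_n -> R) : Prop :=
  forall k, Ck k D f.

(* [chart_inv] is only relevant on the image of [chart_dom]. *)
Record chart (X : topologicalType) (n : nat) := Chart {
  chart_dom : set X;
  chart_map : X -> 'rV[R]_n;
  chart_inv : 'rV[R]_n -> X;
  chart_dom_open : open chart_dom;
  chart_im_open : open (chart_map @` chart_dom);
  chart_mapK : forall x, chart_dom x -> chart_inv (chart_map x) = x;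
  chart_map_cont : forall x, chart_dom x -> {for x, continuous chart_map};
  chart_inv_cont : forall x, chart_dom x ->
    {for chart_map x, continuous chart_inv} }.

Definition chart_compat (X : topologicalType) (n : nat) (c d : chart X n) :=
  forall i : 'I_n,
    Cinfty (chart_map c @` (chart_dom c `&` chart_dom d))
      (fun y => chart_map d (chart_inv c y) 0 i).

Record manifold := Manifold {
  mcarrier :> topologicalType;
  mdim : nat;
  atlas : set (chart mcarrier mdim);
  m_hausdorff : hausdorff_space mcarrier;
  m_second_countable : @second_countable mcarrier;
  atlas_cover : forall x, exists2 c, atlas c & chart_dom c x;
  atlas_compat : forall c d, atlas c -> atlas d -> chart_compat c d }.

Definition smooth_on (X : manifold) (U : set X) (f : X -> R) : Prop :=
  forall c, atlas c ->
    Cinfty (chart_map c @` (U `&` chart_dom c)) (fun y => f (chart_inv c y)).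

Lemma Cinfty_cst n (D : set 'rV[R]_n) (a : R) : Cinfty D (fun=> a).
Proof.
move=> k; elim: k a => [|k IHk] a.
  by split=> // x _; exact: cst_continuous.
split=> [x _|i]; [exact: cst_continuous|].
split=> [x _|]; [exact: derivable_cst|].
have -> : (fun x => 'D_(basis_vec i) (fun=> a) x) = fun=> 0.
  by apply/funext => x; rewrite derive_cst.
exact: IHk.
Qed.

End Manifold.

(** * The ground field k: real or complex numbers *)

Variant ground := Reals | Complexes.

Section Ground.
Variables (R : realType) (k : ground).

Definition ground_field : numFieldType :=
  match k with Reals => (R : numFieldType) | Complexes => R[i] end.

Definition ground_re : ground_field -> R :=
  match k return (match k with Reals => (R : numFieldType)
                             | Complexes => R[i] end) -> R with
  | Reals => fun x => x
  | Complexes => fun z => complex.Re z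
  end.

Definition ground_im : ground_field -> R :=
  match k return (match k with Reals => (R : numFieldType)
                             | Complexes => R[i] end) -> R with
  | Reals => fun=> 0
  | Complexes => fun z => complex.Im z
  end.

End Ground.

(** * Bundles *)

Section Bundles.
Variables (R : realType) (k : ground) (X : manifold R).
Notation K := (ground_field R k).

Definition smooth_vec (V : vectType K) (U : set X) (f : X -> V) : Prop :=
  forall i, let g x := coord (vbasis fullv) i (f x) in
    smooth_on U (fun x => ground_re (g x)) /\
    smooth_on U (fun x => ground_im (g x)).

(* A local trivialization of the family [E] over [ltriv_dom]; the values of
   [ltriv_map] outside of [ltriv_dom] are irrelevant. *)
Record ltriv (E : X -> vectType K) := LTriv {
  ltriv_dom : set X;
  ltriv_model : vectType K;
  ltriv_map : forall x, 'Hom(E x, ltriv_model);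
  ltriv_open : open ltriv_dom;
  ltriv_bij : forall x, ltriv_dom x -> bijective (ltriv_map x) }.

Definition smooth_map_in (E F : X -> vectType K) (t : ltriv E) (s : ltriv F)
    (f : forall x, 'Hom(E x, F x)) : Prop :=
  forall v : ltriv_model t,
    smooth_vec (ltriv_dom t `&` ltriv_dom s)
      (fun x => ltriv_map s x (f x ((ltriv_map t x)^-1%VF v))).

Definition ltriv_compat (E : X -> vectType K) (t s : ltriv E) : Prop :=
  smooth_map_in t s (fun x => \1%VF) /\ smooth_map_in s t (fun x => \1%VF).

(* The structure of a smooth vector bundle on a family of vector spaces. *)
Record vbundle (E : X -> vectType K) := VBundle {
  vb_atlas : ltriv E -> Prop;
  vb_cover : forall x, exists2 t, vb_atlas t & ltriv_dom t x;
  vb_compat : forall t s, vb_atlas t -> vb_atlas s -> ltriv_compat t s }.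

Definition smooth_ltriv (E : X -> vectType K) (vE : vbundle E) (t : ltriv E) :=
  forall s, vb_atlas vE s -> ltriv_compat t s.

Definition smooth_map (E F : X -> vectType K) (vE : vbundle E) (vF : vbundle F)
    (f : forall x, 'Hom(E x, F x)) : Prop :=
  forall t s, vb_atlas vE t -> vb_atlas vF s -> smooth_map_in t s f.

(* Smoothness of the bundle map E (x) F -> G given by a family of bilinear
   maps. *)
Definition smooth_bilin (E F G : X -> vectType K)
    (vE : vbundle E) (vF : vbundle F) (vG : vbundle G)
    (b : forall x, 'Hom(E x, 'Hom(F x, G x))) : Prop :=
  forall t s r, vb_atlas vE t -> vb_atlas vF s -> vb_atlas vG r ->
  forall (v : ltriv_model t) (w : ltriv_model s),
    smooth_vec (ltriv_dom t `&` ltriv_dom s `&` ltriv_dom r)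
      (fun x => ltriv_map r x
         (b x ((ltriv_map t x)^-1%VF v) ((ltriv_map s x)^-1%VF w))).

(* [phi] restricts to a smooth trivialization over [U] with model [V]. *)
Definition trivialization (E : X -> vectType K) (vE : vbundle E)
    (U : set X) (V : vectType K) (phi : forall x, 'Hom(E x, V)) : Prop :=
  exists (Uo : open U) (phib : forall x, U x -> bijective (phi x)),
    smooth_ltriv vE (LTriv Uo phib).

Definition salg_trivialization (A : X -> salg K) (vA : vbundle A)
    (U : set X) (A0 : salg K) (phi : forall x, 'Hom(A x, A0)) : Prop :=
  trivialization vA U phi /\ forall x, U x -> salg_hom (phi x).

Definition salg_locally_trivial (A : X -> salg K) (vA : vbundle A) : Prop :=
  forall x, exists (U : set X) (A0 : salg K) (phi : forall y, 'Hom(A y, A0)),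
    U x /\ salg_trivialization vA U phi.

Record salgbdl := SAlgBdl {
  salg_fib :> X -> salg K;
  salg_vb : vbundle salg_fib;
  salg_loc : salg_locally_trivial salg_vb }.

Definition sbimod_locally_trivial (A B : salgbdl)
    (M : forall x, sbimod (A x) (B x)) (vM : vbundle M) : Prop :=
  forall x, exists (U : set X) (A0 B0 : salg K) (M0 : sbimod A0 B0)
    (phi : forall y, 'Hom(A y, A0)) (psi : forall y, 'Hom(B y, B0))
    (u : forall y, 'Hom(M y, M0)),
    [/\ U x, salg_trivialization (salg_vb A) U phi,
        salg_trivialization (salg_vb B) U psi, trivialization vM U u
      & forall y, U y -> even_map (u y) /\
          forall a m b,
            u y (ract (M y) (lact (M y) a m) b) =
            ract M0 (lact M0 (phi y a) (u y m)) (psi y b)].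

Record sbimodbdl (A B : salgbdl) := SBimodBdl {
  sbimod_fib :> forall x, sbimod (A x) (B x);
  sbimod_vb : vbundle sbimod_fib;
  sbimod_loc : sbimod_locally_trivial sbimod_vb }.

Definition implementing (A B : salgbdl) (M : sbimodbdl A B) : Prop :=
  forall x, implementing_sbimod (M x).

Definition bdl_intertwiner (A B : salgbdl) (M N : sbimodbdl A B)
    (f : forall x, 'Hom(M x, N x)) : Prop :=
  smooth_map (sbimod_vb M) (sbimod_vb N) f /\ forall x, intertwiner (f x).

(* [P] is the fibrewise relative tensor product of [M] and [N], with a vector
   bundle structure that makes the projection from M (x) N smooth. *)
Definition bdl_rel_tensor (A B C : salgbdl)
    (M : sbimodbdl A B) (N : sbimodbdl B C) (P : sbimodbdl A C) : Prop :=
  exists t : forall x, 'Hom(M x, 'Hom(N x, P x)),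
    smooth_bilin (sbimod_vb M) (sbimod_vb N) (sbimod_vb P) t /\
    forall x, is_rel_tensor (t x).

Definition bdl_graded_tensor (A B T : salgbdl) : Prop :=
  exists t : forall x, 'Hom(A x, 'Hom(B x, T x)),
    smooth_bilin (salg_vb A) (salg_vb B) (salg_vb T) t /\
    forall x, is_graded_tensor (t x).

Fact regular_loc (A : salgbdl) :
  @sbimod_locally_trivial A A (fun x => regular_sbimod (A x)) (salg_vb A).
Proof.
move=> x; have [U [A0 [phi [Ux [phiT phiH]]]]] := salg_loc A x.
exists U, A0, A0, (regular_sbimod A0), phi, phi, phi; split=> // y Uy.
have [phi_even _ phiM] := phiH y Uy.
by split=> // a m b /=; rewrite !phiM.
Qed.

(* The identity 1-morphism of [A]. *)
Definition regular_bdl (A : salgbdl) : sbimodbdl A A :=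
  @SBimodBdl A A (fun x => regular_sbimod (A x)) (salg_vb A) (regular_loc A).

Section TrivialBundle.
Variable A0 : salg K.

Fact trivial_open : open [set: X]. Proof. exact: openT. Qed.

Fact trivial_bij (x : X) : [set: X] x -> bijective (\1%VF : 'End(A0)).
Proof. by exists id => v; rewrite id_lfunE. Qed.

Definition trivial_ltriv : ltriv (fun _ : X => A0) :=
  @LTriv (fun=> A0) setT A0 (fun=> \1%VF) trivial_open trivial_bij.

Fact trivial_compat : ltriv_compat trivial_ltriv trivial_ltriv.
Proof.
suff H : smooth_map_in trivial_ltriv trivial_ltriv (fun=> \1%VF) by [].
move=> v i g.
have -> : g = fun=> coord (vbasis fullv) i (((\1)^-1 : 'End(A0))%VF v).
  by apply/funext => x; rewrite /g /= !id_lfunE.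
by split=> c _; exact: Cinfty_cst.
Qed.

Fact trivial_cover x : exists2 t, t = trivial_ltriv & ltriv_dom t x.
Proof. by exists trivial_ltriv. Qed.

Fact trivial_atlas_compat t s :
  t = trivial_ltriv -> s = trivial_ltriv -> ltriv_compat t s.
Proof. by move=> -> ->; exact: trivial_compat. Qed.

Definition trivial_vb : vbundle (fun _ : X => A0) :=
  @VBundle _ (fun t => t = trivial_ltriv) trivial_cover trivial_atlas_compat.

Fact trivial_loc : @salg_locally_trivial (fun=> A0) trivial_vb.
Proof.
move=> x; exists setT, A0, (fun=> \1%VF); split=> //; split; last first.
  move=> y _; split=> [i v|| a b]; rewrite ?id_lfunE //.
by exists trivial_open, trivial_bij => s ->; exact: trivial_compat.
Qed.

Definition trivial_salgbdl : salgbdl := SAlgBdl trivial_loc.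

End TrivialBundle.

(** * Bicategories of super algebra bundles *)

(* A bicategory of super algebra bundles over [X] is given by its objects, its
   1-morphisms B -> A (which are A-B-bimodule bundles) and its 2-morphisms.
   Composition is the relative tensor product, identities are the regular
   bimodule bundles, and the monoidal product is the fibrewise graded tensor
   product; the two products are determined up to unique isomorphism by their
   universal properties. *)
Record bicat := Bicat {
  ob : salgbdl -> Prop;
  mor1 : forall A B : salgbdl, sbimodbdl A B -> Prop;
  mor2 : forall (A B : salgbdl) (M N : sbimodbdl A B),
    (forall x, 'Hom(M x, N x)) -> Prop }.

Section InBicat.
Variable C : bicat.

Definition invertible2 (A B : salgbdl) (M N : sbimodbdl A B)
    (f : forall x, 'Hom(M x, N x)) : Prop :=
  exists g : forall x, 'Hom(N x, M x),
    mor2 C g /\ forall x, (g x \o f x = \1)%VF /\ (f x \o g x = \1)%VF.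

Definition isomorphic1 (A B : salgbdl) (M N : sbimodbdl A B) : Prop :=
  exists f : forall x, 'Hom(M x, N x), mor2 C f /\ invertible2 f.

Definition invertible1 (A B : salgbdl) (M : sbimodbdl A B) : Prop :=
  exists N : sbimodbdl B A,
    [/\ mor1 C N,
        exists P, [/\ mor1 C P, bdl_rel_tensor M N P
                    & isomorphic1 P (regular_bdl A)]
      & exists Q, [/\ mor1 C Q, bdl_rel_tensor N M Q
                    & isomorphic1 Q (regular_bdl B)]].

Definition equivalent (A B : salgbdl) : Prop :=
  exists M : sbimodbdl A B, mor1 C M /\ invertible1 M.

Definition invertible_ob (A : salgbdl) : Prop :=
  exists A' T, [/\ ob C A', ob C T, bdl_graded_tensor A A' T
                 & equivalent T (trivial_salgbdl (ground_salg K))].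

End InBicat.

Definition sAlgBdl : bicat :=
  @Bicat (fun=> True) implementing bdl_intertwiner.

Definition Grpd (C : bicat) : bicat :=
  @Bicat (ob C)
    (fun A B M => mor1 C M /\ invertible1 C M)
    (fun A B M N f => mor2 C f /\ invertible2 C f).

Definition full_sub (C : bicat) (P : salgbdl -> Prop) : bicat :=
  @Bicat (fun A => ob C A /\ P A) (mor1 C) (mor2 C).

Definition ss_sAlgBdl : bicat :=
  full_sub sAlgBdl (fun A => forall x, semisimple_salg (A x)).

Definition fibrewise_invertible (A : salgbdl) : Prop :=
  forall x, invertible_salg (A x).

Definition fibrewise_central_simple (A : salgbdl) : Prop :=
  forall x, central_simple (A x).

End Bundles.

(* Main.v *)
Require Import Defs.
From HB Require Import structures.
From mathcomp Require Import all_boot all_order all_algebra.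
From mathcomp Require Import all_classical all_reals all_analysis.

(** An object of either bicategory is invertible exactly when its fibres are
    central simple, and the fibres are invertible exactly under the same condition.
    The proof compares all three with fibrewise central simplicity.

    Restriction to a point turns invertibility data of a bundle into invertibility
    data of its fibre ([invertible_ob_fibrewise]).

    An invertible super algebra is central simple
    ([invertible_central_simple]).  Suppose that [A (x) A'] is a super algebra [T]
    that is Morita equivalent to the ground field through bimodules [M] and [N] of
    dimensions [m] and [n].  Since [M (x) N] is the faithful bimodule [T], both [M]
    and [N] are faithful, so that [mn = dim T] is at most [m^2] and at most [n^2].
    Hence [m = n] and [T = End M] ([equivalent_ground_End]).  Simplicity and
    centrality of [End M] then descend to the tensor factor [A]
    ([tensor_factor_central_simple]).

    Conversely, a central simple super algebra [A] acts on itself from both sides,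
    and this action identifies [A (x) A^op] with [End A] ([two_sided_tensor]); the
    point is its injectivity ([two_sided_indep]), a graded version of the classical
    argument with a shortest relation.  So [End A] is a model of the tensor product,
    and it is Morita equivalent to the ground field through [A] and its dual
    ([std_dual_rel_tensor], [dual_std_rel_tensor]).

    These constructions are natural, so that they can be carried out in families:
    [A^op] lives on the vector bundle of [A], and [End A] and the dual of [A] on
    bundles of linear maps ([hom_vb]).  In trivializations of [A] by algebra
    isomorphisms all the structure maps are constant, which yields both local
    triviality and smoothness ([smooth_bilin_local]).

    The 1-morphisms must be implementing bimodule bundles.  For the bimodule [A]
    over [End A], its dual and regular bimodules, an automorphism [phi] close to an
    implemented one is implemented by a map [u] given by an explicit formula linear
    in [phi] ([std_implementing], [dual_implementing], [regular_implementing]).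
    These local sections make the projections from the implementer groups open
    ([open_map_of_sections]).

    In the semisimple case one also uses that [A^op] and [End A] are simple. *)

Set Implicit Arguments.
Unset Strict Implicit.
Unset Printing Implicit Defensive.

Import Order.TTheory GRing.Theory Num.Theory.
Import numFieldNormedType.Exports.
Import VectorInternalTheory.

Local Open Scope classical_set_scope.
Local Open Scope ring_scope.

(** * Linear maps, ideals and dimension *)

Section LinearAlgebra.
Variable K : fieldType.
Implicit Types U V W : vectType K.

Lemma linfunP U V (f : U -> V) : linear f -> linfun f =1 f.
Proof.
move=> fL u; pose F : {linear U -> V} := HB.pack f (GRing.isLinear.Build K U V _ f fL).
exact: (lfunE F).
Qed.

Definition bilfun U V W (f : U -> V -> W) : 'Hom(U, 'Hom(V, W)) :=
  linfun (fun u => linfun (f u)).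

Lemma bilfunE U V W (f : U -> V -> W) :
  (forall v, linear (f^~ v)) -> (forall u, linear (f u)) ->
  forall u v, bilfun f u v = f u v.
Proof.
move=> fl fr u v; rewrite linfunP ?linfunP // => c x y.
by apply/lfunP => w; rewrite add_lfunE scale_lfunE !linfunP // fl.
Qed.

Lemma bilDl U V W (b : 'Hom(U, 'Hom(V, W))) x y z : b (x + y) z = b x z + b y z.
Proof. by rewrite linearD add_lfunE. Qed.

Lemma bilDr U V W (b : 'Hom(U, 'Hom(V, W))) x y z : b z (x + y) = b z x + b z y.
Proof. by rewrite linearD. Qed.

Lemma bilZl U V W (b : 'Hom(U, 'Hom(V, W))) c x y : b (c *: x) y = c *: b x y.
Proof. by rewrite linearZ /= scale_lfunE. Qed.

Lemma bilZr U V W (b : 'Hom(U, 'Hom(V, W))) c x y : b x (c *: y) = c *: b x y.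
Proof. by rewrite linearZ. Qed.

Lemma bil0l U V W (b : 'Hom(U, 'Hom(V, W))) y : b 0 y = 0.
Proof. by rewrite linear0 zero_lfunE. Qed.

Lemma bil0r U V W (b : 'Hom(U, 'Hom(V, W))) x : b x 0 = 0.
Proof. by rewrite linear0. Qed.

Lemma exists_functional V (v : V) : v != 0 ->
  exists phi : 'Hom(V, K^o), phi v = 1.
Proof.
move=> v0; have [i vi] : exists i, coord (vbasis fullv) i v != 0.
  apply/existsP; apply: contraNT v0 => /existsPn H; apply/eqP.
  rewrite (coord_vbasis (memvf v)) big1 // => i _.
  by have /negPn/eqP -> := H i; rewrite scale0r.
pose c := coord (vbasis fullv) i v.
exists (linfun (fun w => c^-1 *: (coord (vbasis fullv) i w : K^o))).
rewrite linfunP => [|a x y]; first exact: mulVf.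
by rewrite linearP scalerDr !scalerA [c^-1 * a]mulrC.
Qed.

(** The image of [w (x) phi] in [Hom(V, W)]. *)
Definition rank1 V W (w : W) (phi : 'Hom(V, K^o)) : 'Hom(V, W) :=
  linfun (fun v => (phi v : K) *: w).

Lemma rank1E V W (w : W) (phi : 'Hom(V, K^o)) v : rank1 w phi v = (phi v : K) *: w.
Proof. by rewrite linfunP // => c x y; rewrite linearP scalerDl scalerA. Qed.

Definition dual_basis V (i : 'I_(\dim (fullv : {vspace V}))) : 'Hom(V, K^o) :=
  linfun (fun v => coord (vbasis fullv) i v : K^o).

Lemma dual_basisE V i (v : V) : dual_basis i v = coord (vbasis fullv) i v.
Proof. by rewrite linfunP // => c x y; rewrite linearP. Qed.

Lemma rank1_sum V W (f : 'Hom(V, W)) :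
  f = \sum_(i < \dim (fullv : {vspace V})) rank1 (f (vbasis fullv)`_i) (dual_basis i).
Proof.
apply/lfunP => v; rewrite sum_lfunE [in LHS](coord_vbasis (memvf v)) linear_sum.
by apply: eq_bigr => i _; rewrite linearZ rank1E dual_basisE.
Qed.

Lemma dual_sum V (phi : 'Hom(V, K^o)) :
  phi = \sum_(i < \dim (fullv : {vspace V})) (phi (vbasis fullv)`_i : K) *: dual_basis i.
Proof.
apply/lfunP => v; rewrite sum_lfunE [in LHS](coord_vbasis (memvf v)) linear_sum.
apply: eq_bigr => i _; rewrite linearZ scale_lfunE dual_basisE.
exact: mulrC.
Qed.

(** If [phi (f v) = 1], then [w (x) psi = (w (x) phi) f (v (x) psi)]; so an ideal
    containing [f] contains all rank-one maps, and these span [End V]. *)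
Lemma End_ideal_full V (J : 'End(V) -> Prop) :
  J 0 -> (forall f g, J f -> J g -> J (f + g)) ->
  (forall f g, J f -> J (g \o f)%VF) -> (forall f g, J f -> J (f \o g)%VF) ->
  forall f, f != 0 -> J f -> forall g, J g.
Proof.
move=> J0 JD Jl Jr f f0 Jf g.
have [v fv] : exists v, f v != 0.
  by have /lfunPn[v] := f0; rewrite zero_lfunE => ?; exists v.
have [phi phi1] := exists_functional fv.
rewrite (rank1_sum g); elim/big_rec: _ => // i x _ Jx; apply: JD => //.
set w := g _; set psi := dual_basis i.
have -> : rank1 w psi = (rank1 w phi \o (f \o rank1 v psi))%VF.
  apply/lfunP => x'; rewrite !comp_lfunE !rank1E !linearZZ /= phi1.
  by rewrite /GRing.scale /= mulr1.
exact/Jl/Jr.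
Qed.

(** Commuting with [v (x) phi], where [phi v0 = 1], gives [f v = phi (f v0) v]. *)
Lemma End_center_scalar V (f : 'End(V)) :
  (forall g, (f \o g = g \o f)%VF) -> exists c : K, f = c *: \1%VF.
Proof.
move=> fC; have [V0|[v0 v00]] : (forall v : V, v = 0) \/ exists v : V, v != 0.
- case: (pselect (exists v : V, v != 0)) => [|H]; [by right|left=> v].
  by apply: contrapT => /eqP v0; apply: H; exists v.
- exists 0; apply/lfunP => v; rewrite scale0r zero_lfunE; exact: V0.
have [phi phi1] := exists_functional v00.
exists (phi (f v0)); apply/lfunP => v; rewrite scale_lfunE id_lfunE.
have /lfunP/(_ v0) := fC (rank1 v phi).
by rewrite !comp_lfunE !rank1E phi1 scale1r.
Qed.

Lemma bij_lfunK U V (f : 'Hom(U, V)) : bijective f -> cancel f f^-1%VF.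
Proof. by move=> /bij_inj/lker0P; exact: lker0_lfunK. Qed.

Lemma bij_lfunVK U V (f : 'Hom(U, V)) : bijective f -> cancel f^-1%VF f.
Proof. by move=> fb; have [g gK Kg] := fb; move=> v; rewrite -[v]Kg bij_lfunK. Qed.

Lemma bij_dim U V (f : 'Hom(U, V)) : bijective f -> dim U = dim V.
Proof.
move=> fb; have fV := bij_lfunVK fb.
have k0 : lker f = 0%VS by apply/eqP/lker0P; exact: bij_inj fb.
rewrite -!dimvf -(@limg_dim_eq _ _ _ f) ?k0 ?capv0 //; congr (\dim _).
apply/vspaceP => v; rewrite memvf; apply/memv_imgP.
by exists (f^-1%VF v); rewrite ?memvf.
Qed.

Lemma inj_dim_bij U V (f : 'Hom(U, V)) :
  injective f -> (dim V <= dim U)%N -> bijective f.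
Proof.
move=> fi le; have k0 : lker f = 0%VS by apply/eqP/lker0P.
have fV v : f (f^-1%VF v) = v.
  apply: limg_lfunVK; suff -> : limg f = fullv by exact: memvf.
  apply/eqP; rewrite eqEdim subvf /= limg_dim_eq ?k0 ?capv0 //.
  by rewrite !dimvf.
by exists f^-1%VF => // v; exact/fi.
Qed.

Lemma inj_dim_le U V (f : 'Hom(U, V)) : injective f -> (dim U <= dim V)%N.
Proof.
move=> fi; have k0 : lker f = 0%VS by apply/eqP/lker0P.
by rewrite -!dimvf -(@limg_dim_eq _ _ _ f fullv) ?k0 ?capv0 // dimvS ?subvf.
Qed.

Lemma dim_End V : dim 'End(V) = (dim V * dim V)%N.
Proof. by []. Qed.

(** A subspace of maximal dimension among those on which [P] holds is all of [P],
    as it could be enlarged by any missing vector. *)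
Lemma vspace_of_pred V (P : V -> Prop) :
  P 0 -> (forall c u v, P u -> P v -> P (c *: u + v)) ->
  exists U : {vspace V}, forall v, v \in U <-> P v.
Proof.
move=> P0 PL.
pose Q n := `[< exists U : {vspace V}, (forall v, v \in U -> P v) /\ \dim U = n >].
have exQ : exists n, Q n.
  exists 0%N; apply/asboolP; exists 0%VS; split=> [v|]; last exact: dimv0.
  by rewrite memv0 => /eqP ->.
have bQ n : Q n -> (n <= dim V)%N.
  by move=> /asboolP[U [_ <-]]; rewrite -dimvf dimvS ?subvf.
case: (ex_maxnP exQ bQ) => n /asboolP[U [UP Un]] nmax.
exists U => v; split=> [/UP //|Pv].
apply: contrapT => /negP vU.
have PU w : w \in (<[v]> + U)%VS -> P w.
  by move=> /memv_addP[_ /vlineP[c ->] [u /UP Pu ->]]; exact: PL.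
have := nmax (\dim (<[v]> + U)); have -> : Q (\dim (<[v]> + U)).
  by apply/asboolP; exists (<[v]> + U)%VS.
rewrite -Un => /(_ isT); rewrite leqNgt => /negP; apply.
have UsU : (U <= <[v]> + U)%VS := addvSr _ _.
rewrite (ltn_leqif (dimv_leqif_eq UsU)); apply: contra vU => /eqP ->.
exact/(subvP (addvSl _ _))/memv_line.
Qed.

End LinearAlgebra.

(** * Gradings *)

Section Gradings.
Variable K : fieldType.
Implicit Types V W : svect K.

Lemma homogeneous_ind V (P : V -> Prop) :
  (forall u v, P u -> P v -> P (u + v)) ->
  (forall i v, v \in part V i -> P v) -> forall v, P v.
Proof.
move=> PD Ph v; have : v \in (part V false + part V true)%VS.
  by rewrite part_sum memvf.
by move=> /memv_addP[v0 /Ph P0 [v1 /Ph P1 ->]]; exact: PD.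
Qed.

Definition hproj V (i : bool) : 'End(V) := daddv_pi (part V i) (part V (~~ i)).

Lemma part_capC V i : (part V i :&: part V (~~ i) = 0)%VS.
Proof. by case: i => /=; [rewrite capvC|]; rewrite part_cap. Qed.

Lemma hproj_in V i v : hproj V i v \in part V i.
Proof. exact: memv_pi. Qed.

Lemma hproj_id V i v : v \in part V i -> hproj V i v = v.
Proof. by move=> vi; rewrite daddv_pi_id // part_capC. Qed.

Lemma hprojD V v : v = hproj V false v + hproj V true v.
Proof. by rewrite /hproj /= daddv_pi_add // ?part_sum ?memvf // part_cap. Qed.

Lemma hproj_homog V i j v : v \in part V j -> hproj V i v = if i == j then v else 0.
Proof.
move=> vj; case: eqP => [->|/eqP nij]; first exact: hproj_id.
have -> : i = ~~ j by case: i j nij {vj} => -[].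
apply: (addrI (hproj V j v)); rewrite addr0 [in RHS](hproj_id vj) [RHS]hprojD.
by case: j {vj nij} => //=; rewrite addrC.
Qed.

(** The [j]-th power of the grading automorphism: the Koszul sign [(-1)^(j |v|)] in
    front of a homogeneous [v], extended linearly to all [v].  The lock keeps [add_lfunE] from seeing the difference of
    projections. *)
Definition tw_def V (j : bool) : 'End(V) :=
  if j then hproj V false - hproj V true else \1%VF.
Fact tw_key : unit. Proof. exact: tt. Qed.
Definition tw := locked_with tw_key tw_def.
Lemma tw_unfold : tw = tw_def. Proof. exact: unlock. Qed.

Lemma twE V i j v : v \in part V i -> tw V j v = (-1) ^+ (i && j) *: v.
Proof.
move=> vi; rewrite tw_unfold /tw_def; case: j; rewrite ?andbF ?andbT ?expr0 ?scale1r ?id_lfunE //.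
rewrite /= add_lfunE opp_lfunE !(hproj_homog _ vi).
by case: i vi => _ /=; rewrite ?expr1 ?expr0 ?scale1r ?scaleN1r ?sub0r ?subr0.
Qed.

Lemma tw0 V v : tw V false v = v.
Proof. by rewrite tw_unfold id_lfunE. Qed.

Lemma tw_part V i j v : v \in part V i -> tw V j v \in part V i.
Proof. by move=> vi; rewrite (twE _ vi) memvZ. Qed.

Lemma tw_tw V i j v : tw V i (tw V j v) = tw V (i (+) j) v.
Proof.
elim/homogeneous_ind: v => [u v IHu IHv|d v vd]; first by rewrite !linearD /= IHu IHv.
rewrite !(twE _ vd) linearZ /= (twE _ vd) scalerA -exprD -(signr_odd _ (_ + _)).
by rewrite oddD !oddb; case: d i j {vd} => -[] [].
Qed.

Lemma twK V j : involutive (tw V j).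
Proof. by move=> v; rewrite tw_tw addbb tw0. Qed.

End Gradings.

Arguments tw {K} V j.

Section Algebras.
Variable K : fieldType.
Implicit Types A : salg K.

Lemma tw_smul A j a b : tw A j (smul A a b) = smul A (tw A j a) (tw A j b).
Proof.
elim/homogeneous_ind: a => [u v IHu IHv|d a ad].
  by rewrite bilDl [tw A j (u + v)]linearD bilDl linearD /= IHu IHv.
elim/homogeneous_ind: b => [u v IHu IHv|e b be]; first by rewrite !linearD /= IHu IHv.
rewrite (twE _ ad) (twE _ be) bilZl bilZr (twE _ (smul_even ad be)) scalerA.
by rewrite -exprD -(signr_odd _ (_ + _)) oddD !oddb; case: d e j {ad be} => -[] [].
Qed.

Lemma tw_sone A j : tw A j (sone A) = sone A.
Proof. by rewrite (twE _ (sone_even A)) expr0 scale1r. Qed.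

End Algebras.

(** * Invertible super algebras are central simple *)

Section RelativeTensors.
Variable K : fieldType.

Definition postcomp (U V W W' : vectType K) (f : 'Hom(W, W'))
    (s : 'Hom(U, 'Hom(V, W))) : 'Hom(U, 'Hom(V, W')) :=
  linfun (fun u => (f \o s u)%VF).

Lemma postcompE (U V W W' : vectType K) (f : 'Hom(W, W'))
    (s : 'Hom(U, 'Hom(V, W))) u v : postcomp f s u v = f (s u v).
Proof.
rewrite linfunP ?comp_lfunE // => c x y.
by rewrite linearP /= comp_lfunDr -comp_lfunZr.
Qed.

(** The uniqueness half of the universal property, for maps [f] and [g] that are
    not given as extensions: both extend [f o t]. *)
Lemma rel_tensor_ext (A B C : salg K) (M : sbimod A B) (N : sbimod B C)
    (P : sbimod A C) (t : 'Hom(M, 'Hom(N, P))) : is_rel_tensor t ->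
  forall (W : vectType K) (f g : 'Hom(P, W)),
    (forall m n, f (t m n) = g (t m n)) -> f = g.
Proof.
case=> tb _ _ _ tU W f g fg.
have sb : balanced (postcomp f t) by move=> m b n; rewrite !postcompE tb.
have [h [_ hU]] := tU W _ sb.
by rewrite -(hU f) ?(hU g) // => m n; rewrite postcompE ?fg.
Qed.

Lemma graded_tensor_ext (A B T : salg K) (t : 'Hom(A, 'Hom(B, T))) :
  is_graded_tensor t -> forall (W : vectType K) (f g : 'Hom(T, W)),
    (forall a b, f (t a b) = g (t a b)) -> f = g.
Proof.
case=> _ _ _ tU W f g fg; have [h [_ hU]] := tU W (postcomp f t).
by rewrite -(hU f) ?(hU g) // => m n; rewrite postcompE ?fg.
Qed.

(** The projection onto [U] and the identity agree on all pure tensors. *)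
Lemma graded_tensor_span (A B T : salg K) (t : 'Hom(A, 'Hom(B, T)))
    (U : {vspace T}) :
  is_graded_tensor t -> (forall a b, t a b \in U) -> forall x, x \in U.
Proof.
move=> tT tU x; suff /lfunP/(_ x) : (projv U = \1)%VF.
  by rewrite id_lfunE => <-; exact: memv_proj.
by apply: (graded_tensor_ext tT) => a b; rewrite id_lfunE projv_id.
Qed.

Definition rmul (A : salg K) (b : A) : 'End(A) := linfun (fun a => smul A a b).

Lemma rmulE (A : salg K) (a b : A) : rmul b a = smul A a b.
Proof. by rewrite linfunP // => c x y; rewrite bilDl bilZl. Qed.

Lemma ract_ground (A : salg K) (M : sbimod A (ground_salg K)) m (c : ground_salg K) :
  ract M m c = (c : K) *: m.
Proof.
have cE : c = (c : K) *: sone (ground_salg K) by rewrite /GRing.scale /= mulr1.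
by rewrite {1}cE bilZr ract1.
Qed.

Lemma lact_ground (A : salg K) (M : sbimod (ground_salg K) A) m (c : ground_salg K) :
  lact M c m = (c : K) *: m.
Proof.
have cE : c = (c : K) *: sone (ground_salg K) by rewrite /GRing.scale /= mulr1.
by rewrite {1}cE bilZl lact1.
Qed.

Lemma balanced_ground (A C : salg K) (M : sbimod A (ground_salg K))
    (N : sbimod (ground_salg K) C) (W : vectType K) (s : 'Hom(M, 'Hom(N, W))) :
  balanced s.
Proof. by move=> m b n; rewrite ract_ground lact_ground bilZl bilZr. Qed.

(** The outer products of coordinate vectors span the matrices, so a tensor
    product over the ground field has at least the expected dimension. *)
Lemma rel_tensor_ground_dim (A C : salg K) (M : sbimod A (ground_salg K))
    (N : sbimod (ground_salg K) C) (P : sbimod A C) (t : 'Hom(M, 'Hom(N, P))) :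
  is_rel_tensor t -> (dim M * dim N <= dim P)%N.
Proof.
case=> _ _ _ _ tU.
pose b (x : M) (y : N) : 'M[K]_(dim M, dim N) := (v2r x)^T *m v2r y.
have bE : forall x y, bilfun b x y = b x y.
  apply: bilfunE => [y c x x'|x c y y']; rewrite /b linearP /=.
    by rewrite linearP /= mulmxDl scalemxAl.
  by rewrite mulmxDr scalemxAr.
have [f [fE _]] := tU _ (bilfun b) (balanced_ground (bilfun b)).
have fS : limg f = fullv.
  apply/eqP; rewrite eqEsubv subvf; apply/subvP => Z _.
  rewrite (matrix_sum_delta Z); apply: memv_suml => i _; apply: memv_suml => j _.
  apply: memvZ; apply/memv_imgP.
  exists (t (r2v (delta_mx 0 i)) (r2v (delta_mx 0 j))); first exact: memvf.
  by rewrite fE bE /b !r2vK trmx_delta mul_delta_mx.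
have -> : (dim M * dim N = dim 'M[K]_(dim M, dim N))%N.
  by apply/esym; exact: dim_matrix.
have := leq_addl (\dim (fullv :&: lker f)) (\dim (limg f)).
by rewrite limg_ker_dim fS !dimvf.
Qed.

(** Let [T] be Morita equivalent to the ground field through [M] and [N].  As
    [M (x) N = T] is faithful on both sides, so are [M] and [N], whence
    [mn <= dim T <= m^2, n^2] for their dimensions; so [m = n], and the injection
    [T -> End M] is bijective. *)
Lemma equivalent_ground_End (T : salg K) : salg_equivalent T (ground_salg K) ->
  sone T != 0 /\
  exists M : sbimod T (ground_salg K), bijective (lact M : T -> 'End(M)).
Proof.
case=> M [N [[P [t [tT [f [[_ fl fr] fb]]]]] [Q [s [sT [g [_ gb]]]]]]].
(* Were [T] zero, so would be [M], and with it [N (x) M], the ground field. *)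
have T1 : sone T != 0.
  apply/eqP => T0; have M0 (m : M) : m = 0.
    by rewrite -(lact1 m) T0 linear0 zero_lfunE.
  have Q0 : (\1%VF : 'End(Q)) = 0.
    by apply: (rel_tensor_ext sT) => n m; rewrite (M0 m) !linear0.
  have [h hK Kh] := gb.
  have gE (c : ground_salg K) : c = 0.
    by rewrite -[c]Kh -[h c](id_lfunE) Q0 zero_lfunE linear0.
  by have /eqP := gE (1 : K); rewrite oner_eq0.
split=> //; exists M.
have [h hK Kh] := fb.
have Li : injective (lact M : T -> 'End(M)).
  apply/lker0P; rewrite -subv0; apply/subvP => x; rewrite memv_ker memv0 => /eqP x0.
  have P0 : lact P x = 0.
    apply: (rel_tensor_ext tT) => m n; case: tT => _ _ <- _ _.
    by rewrite x0 !zero_lfunE linear0 zero_lfunE.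
  have := fl x (h (sone T)); rewrite P0 zero_lfunE linear0 Kh /=.
  by rewrite smul1r => <-.
have Ri (x : T) : (forall n, ract N n x = 0) -> x = 0.
  move=> x0; have rP (p : P) : ract P p x = 0.
    pose r : 'End(P) := linfun (fun p => ract P p x).
    have rE p' : r p' = ract P p' x by rewrite linfunP // => c u v; rewrite bilDl bilZl.
    rewrite -rE; have -> : r = 0; last by rewrite zero_lfunE.
    apply: (rel_tensor_ext tT) => m n; rewrite rE zero_lfunE; case: tT => _ _ _ <- _.
    by rewrite x0 linear0.
  have := fr (h (sone T)) x; rewrite rP linear0 Kh /=.
  by rewrite smul1l => <-.
pose R : 'Hom(T, 'End(N)) := bilfun (fun x n => ract N n x).
have RE x n : R x n = ract N n x.
  by rewrite /R bilfunE // => [m c u v|y c u v]; rewrite ?bilDl ?bilDr ?bilZl ?bilZr.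
have dR : (dim T <= dim N * dim N)%N.
  rewrite -dim_End; apply: (@inj_dim_le _ _ _ R); apply/lker0P; rewrite -subv0.
  apply/subvP => x; rewrite memv_ker memv0 => /eqP R0; apply/eqP/Ri => n.
  by rewrite -RE R0 zero_lfunE.
(* [m n <= dim T <= m^2] and [dim T <= n^2]. *)
have dP := rel_tensor_ground_dim tT; rewrite (bij_dim fb) in dP.
have dL := inj_dim_le Li; rewrite dim_End in dL.
apply: inj_dim_bij Li _; rewrite dim_End; apply: (leq_trans _ dP).
have T0 : (0 < dim T)%N.
  rewrite -dimvf lt0n dimv_eq0; apply: contra T1 => /eqP T0.
  by have := memvf (sone T); rewrite T0 memv0.
rewrite leq_mul2l leqNgt; apply/orP; right; apply/negP => lt.
have : (dim M * dim N <= dim N * dim N)%N by exact: leq_trans dP dR.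
rewrite leq_mul2r => /orP[/eqP N0|]; last by rewrite leqNgt lt.
by move: (leq_trans T0 dR); rewrite N0.
Qed.

End RelativeTensors.

Section InvertibleCentralSimple.
Variable K : fieldType.

Lemma iso_End_simple (T : salg K) (V : vectType K) (L : 'Hom(T, 'End(V)))
    (J : T -> Prop) :
  bijective L -> (forall x y, L (smul T x y) = (L x \o L y)%VF) ->
  J 0 -> (forall x y, J x -> J y -> J (x + y)) ->
  (forall x y, J x -> J (smul T y x)) -> (forall x y, J x -> J (smul T x y)) ->
  forall x, x != 0 -> J x -> forall y, J y.
Proof.
move=> [h hK Kh] LM J0 JD Jl Jr x x0 Jx y.
have hM f g : h (f \o g)%VF = smul T (h f) (h g).
  by apply: (can_inj hK); rewrite LM !Kh.
have h0 : h 0 = 0 by apply: (can_inj hK); rewrite Kh linear0.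
have hD f g : h (f + g) = h f + h g.
  by apply: (can_inj hK); rewrite linearD /= !Kh.
rewrite -[y]hK; apply: (@End_ideal_full K V (fun f => J (h f)) _ _ _ _ (L x)).
- by rewrite h0.
- by move=> f g Jf Jg; rewrite hD; exact: JD.
- by move=> f g Jf; rewrite hM; exact: Jl.
- by move=> f g Jf; rewrite hM; exact: Jr.
- by apply: contra x0 => /eqP Lx; rewrite -[x]hK Lx h0.
- by rewrite hK.
Qed.

(** If the graded tensor product [T] of [A] and [A'] is a full endomorphism
    algebra, then a graded ideal [I] of [A] spans the ideal [I (x) A'] of [T],
    and an even central [z] gives the central [z (x) 1]; slicing off [A'] by a
    functional brings the conclusions back to [A]. *)
Lemma tensor_factor_central_simple (A A' T : salg K) (t : 'Hom(A, 'Hom(A', T)))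
    (V : vectType K) (L : 'Hom(T, 'End(V))) :
  is_graded_tensor t -> sone T != 0 -> bijective L ->
  (forall x y, L (smul T x y) = (L x \o L y)%VF) -> central_simple A.
Proof.
move=> tT T1 Lb LM; have span := graded_tensor_span tT.
case: (tT) => te t1 tM tU.
have A1 : sone A != 0.
  by apply: contra T1 => /eqP A0; rewrite -t1 A0 bil0l.
have A1' : sone A' != 0 by apply: contra T1 => /eqP A0; rewrite -t1 A0 linear0.
have [l' l1'] := exists_functional A1'.
(* Contracting [A'] with [l'] extends a linear map from [A] to [T]. *)
have slice (W : vectType K) (h : 'Hom(A, W)) :
    exists f : 'Hom(T, W), forall a b, f (t a b) = (l' b : K) *: h a.
  pose s (a : A) (b : A') := (l' b : K) *: h a.
  have sE : forall a b, bilfun s a b = s a b.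
    apply: bilfunE => [b c x y|a c x y]; rewrite /s linearP /=.
      by rewrite scalerDr !scalerA mulrC.
    by rewrite scalerDl scalerA.
  by have [f [fE _]] := tU W (bilfun s); exists f => a b; rewrite fE sE.
have tinj a : t a (sone A') = 0 -> a = 0.
  move=> ta; have [f fE] := slice A \1%VF.
  by have := fE a (sone A'); rewrite ta linear0 l1' scale1r id_lfunE.
split.
  move=> z; split; last first.
    case=> c ->; split=> [|a]; first exact/memvZ/sone_even.
    by rewrite bilZl bilZr smul1l smul1r.
  move=> [z0 zC]; set z' := t z (sone A').
  have z'C x : smul T z' x = smul T x z'.
    suff : x \in lker (smul T z' - rmul z').
      by rewrite memv_ker add_lfunE opp_lfunE rmulE subr_eq0 => /eqP.
    apply: span => a b; rewrite memv_ker add_lfunE opp_lfunE rmulE subr_eq0 /z'.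
    apply/eqP; elim/homogeneous_ind: a => [u v IHu IHv|i a ai].
      by rewrite !bilDl bilDr IHu IHv -bilDl.
    elim/homogeneous_ind: b => [u v IHu IHv|j b bj].
      by rewrite !bilDr IHu IHv -bilDl.
    rewrite (tM _ _ _ _ _ _ (sone_even A') ai) (tM _ _ _ _ _ _ bj z0).
    by rewrite andbF /= expr0 zC smul1l smul1r.
  have [h hK Kh] := Lb.
  have [c Lc] : exists c : K, L z' = c *: \1%VF.
    by apply: End_center_scalar => g; rewrite -[g]Kh -!LM z'C.
  exists c; apply/eqP; rewrite -subr_eq0; apply/eqP/tinj.
  apply: (bij_inj Lb); rewrite linear0 linearB add_lfunE opp_lfunE linearB /=.
  rewrite -/z' Lc bilZl t1 linearZ /=.
  suff -> : L (sone T) = \1%VF by rewrite subrr.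
  by rewrite -[LHS]comp_lfun1r -[X in (_ \o X)%VF]Kh -LM smul1l Kh.
split; first exact/eqP.
move=> I [Il Ir Igr].
have [->|I0] := eqVneq I 0%VS; [by left|right].
have Ihom x : x \in I -> exists y0 y1, [/\ x = y0 + y1, y0 \in I, y1 \in I,
    y0 \in part A false & y1 \in part A true].
  rewrite {1}Igr => /memv_addP[y0 /memv_capP[? ?] [y1 /memv_capP[? ?] ->]].
  by exists y0, y1.
have [x xI x0] : exists2 x, x \in I & x != 0.
  by exists (vpick I); rewrite ?memv_pick ?vpick0.
(* [J] is the span of the tensors [t a b] with [a] in [I]. *)
pose J y := forall U : {vspace T},
  (forall a b, a \in I -> t a b \in U) -> y \in U.
have JT : forall y, J y.
  apply: (@iso_End_simple T V L J Lb LM _ _ _ _ (t x (sone A'))).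
  - by move=> U _; exact: mem0v.
  - by move=> u v Ju Jv U HU; rewrite memvD ?Ju ?Jv.
  - move=> u c Ju U HU; rewrite memv_preim; apply: Ju => a b aI; rewrite -memv_preim.
    rewrite -rmulE memv_preim; apply: span => c1 d; rewrite -memv_preim rmulE.
    have [a0 [a1 [-> a0I a1I a0e a1o]]] := Ihom a aI.
    elim/homogeneous_ind: d => [d d' IHd IHd'|i d di].
      by rewrite bilDr bilDl memvD.
    rewrite bilDl bilDr memvD //.
      by rewrite (tM _ _ _ _ _ _ di a0e) memvZ // HU // Il.
    by rewrite (tM _ _ _ _ _ _ di a1o) memvZ // HU // Il.
  - move=> u c Ju U HU; rewrite -rmulE memv_preim; apply: Ju => a b aI.
    rewrite -memv_preim rmulE memv_preim; apply: span => c1 d; rewrite -memv_preim.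
    elim/homogeneous_ind: b => [b b' IHb IHb'|i b bi].
      by rewrite bilDr bilDl memvD.
    elim/homogeneous_ind: c1 => [u1 v1 IHu IHv|j c1 cj].
      by rewrite bilDl bilDr memvD.
    by rewrite (tM _ _ _ _ _ _ bi cj) memvZ // HU // Ir.
  - by apply: contra x0 => /eqP /tinj ->.
  - by move=> U; exact.
apply/eqP; rewrite eqEsubv subvf; apply/subvP => v _.
have [f fE] := slice A (\1%VF - projv I).
have : t v (sone A') \in lker f.
  apply: JT => a b aI; rewrite memv_ker fE add_lfunE opp_lfunE id_lfunE.
  by rewrite projv_id // subrr scaler0.
rewrite memv_ker fE l1' scale1r add_lfunE opp_lfunE id_lfunE subr_eq0 => /eqP ->.
exact: memv_proj.
Qed.

Lemma invertible_central_simple (A : salg K) : invertible_salg A -> central_simple A.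
Proof.
move=> [A' [T [t [tT /equivalent_ground_End[T1 [M Mb]]]]]].
apply: (tensor_factor_central_simple tT T1 Mb) => x y.
by apply/lfunP => m; rewrite comp_lfunE lactM.
Qed.

End InvertibleCentralSimple.

(** * Endomorphism algebras and opposite algebras *)

Section HomSpaces.
Variable K : numFieldType.
Implicit Types V W : svect K.

(** As 2 is invertible, the two degrees are the eigenspaces of the grading
    automorphism. *)
Lemma part_twP V i v : (v \in part V i) <-> (tw V true v = (-1) ^+ i *: v).
Proof.
split=> [vi|]; first by rewrite (twE _ vi) andbT.
have := hprojD v; set a := hproj V false v; set b := hproj V true v => vE.
have aI : a \in part V false := hproj_in _ _; have bI : b \in part V true := hproj_in _ _.
rewrite vE [tw _ _ _]linearD scalerDr /= (twE _ aI) (twE _ bI) /= expr0 expr1 scale1r scaleN1r.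
have two (u : V) : u + u = 0 -> u = 0.
  rewrite -mulr2n -scaler_nat => /eqP; rewrite scaler_eq0 pnatr_eq0 /=.
  by move/eqP.
case: i; rewrite /= ?expr0 ?expr1 ?scaleN1r ?scale1r.
  move=> /addIr /eqP; rewrite -addr_eq0 => /eqP /two a0.
  by rewrite a0 add0r.
by move=> /addrI/esym /eqP; rewrite -addr_eq0 => /eqP /two ->; rewrite addr0.
Qed.

Definition tw_conj V W (f : 'Hom(V, W)) : 'Hom(V, W) :=
  (tw W true \o f \o tw V true)%VF.

Lemma tw_conjE V W (f : 'Hom(V, W)) v : tw_conj f v = tw W true (f (tw V true v)).
Proof. by rewrite /tw_conj !comp_lfunE. Qed.

Lemma tw_conj_linear V W : linear (@tw_conj V W).
Proof.
move=> c f g; apply/lfunP => v; rewrite add_lfunE scale_lfunE !tw_conjE.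
by rewrite add_lfunE scale_lfunE linearP.
Qed.

(** Maps of degree [i], as an eigenspace; in this form they are a subspace by
    construction, and [hom_partP] gives the usual description. *)
Definition hom_part V W (i : bool) : {vspace 'Hom(V, W)} :=
  lker (linfun (@tw_conj V W) - (-1) ^+ i *: \1)%VF.

Lemma hom_part_tw V W i (f : 'Hom(V, W)) :
  (f \in hom_part V W i) <-> tw_conj f = (-1) ^+ i *: f.
Proof.
rewrite memv_ker add_lfunE opp_lfunE scale_lfunE id_lfunE.
rewrite linfunP; last exact: tw_conj_linear.
by rewrite subr_eq0; split=> [/eqP|->].
Qed.

Lemma hom_partP V W i (f : 'Hom(V, W)) : (f \in hom_part V W i) <->
  (forall j v, v \in part V j -> f v \in part W (i (+) j)).
Proof.
rewrite hom_part_tw; split=> [fi j v vj|fi].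
  apply/part_twP; have /lfunP/(_ v) := fi; rewrite tw_conjE scale_lfunE.
  rewrite (twE _ vj) andbT !linearZ /= => /(congr1 (fun w => (-1) ^+ j *: w)).
  by rewrite !scalerA -expr2 sqrr_sign scale1r => ->; rewrite signr_addb mulrC.
apply/lfunP => v; rewrite tw_conjE scale_lfunE.
elim/homogeneous_ind: v => [u v IHu IHv|j v vj].
  by rewrite !linearD /= IHu IHv -scalerDr.
rewrite (twE _ vj) andbT !linearZ /= (twE _ (fi _ _ vj)) andbT scalerA signr_addb.
by rewrite mulrCA -expr2 sqrr_sign mulr1.
Qed.

Lemma tw_conjK V W : involutive (@tw_conj V W).
Proof. by move=> f; apply/lfunP => v; rewrite !tw_conjE !twK. Qed.

Lemma hom_part_sum V W :
  (hom_part V W false + hom_part V W true = fullv)%VS.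
Proof.
apply/eqP; rewrite eqEsubv subvf; apply/subvP => f _.
have linT := @tw_conj_linear V W.
have fE : f = 2^-1 *: (f + tw_conj f) + 2^-1 *: (f - tw_conj f).
  rewrite -scalerDr addrACA subrr addr0 -mulr2n -[f *+ 2]scaler_nat scalerA.
  by rewrite mulVf ?scale1r // pnatr_eq0.
have TD g h : tw_conj (g + h) = tw_conj g + tw_conj h :> 'Hom(V, W).
  by have := linT 1 g h; rewrite !scale1r.
have TN g : tw_conj (- g) = - tw_conj g :> 'Hom(V, W).
  have := linT (-1) g 0; rewrite !addr0 !scaleN1r => ->.
  by rewrite (_ : tw_conj 0 = 0) ?addr0 //; apply/lfunP => v;
    rewrite tw_conjE !zero_lfunE linear0.
rewrite fE; apply: memv_add; apply: memvZ; apply/hom_part_tw.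
  by rewrite TD tw_conjK expr0 scale1r addrC.
by rewrite TD TN tw_conjK expr1 scaleN1r opprB addrC.
Qed.

Lemma hom_part_cap V W :
  (hom_part V W false :&: hom_part V W true = 0)%VS.
Proof.
apply/eqP; rewrite -subv0; apply/subvP => f /memv_capP[/hom_part_tw f0 /hom_part_tw].
rewrite f0 expr0 expr1 scale1r scaleN1r => /eqP.
rewrite -addr_eq0 -mulr2n -scaler_nat scaler_eq0 pnatr_eq0 /=.
by rewrite memv0.
Qed.

Definition hom_svect V W : svect K :=
  @SVect K 'Hom(V, W) (hom_part V W) (hom_part_sum V W) (hom_part_cap V W).

Definition End_mul V : 'Hom('End(V), 'Hom('End(V), 'End(V))) :=
  bilfun (fun f g : 'End(V) => (f \o g)%VF).

Lemma End_mulE V (f g : 'End(V)) : End_mul V f g = (f \o g)%VF.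
Proof.
rewrite /End_mul bilfunE // => [h c u v|h c u v].
  by rewrite comp_lfunDl -comp_lfunZl.
by rewrite comp_lfunDr -comp_lfunZr.
Qed.

Fact End_mulA V (f g h : 'End(V)) :
  End_mul V f (End_mul V g h) = End_mul V (End_mul V f g) h.
Proof. by rewrite !End_mulE comp_lfunA. Qed.

Fact End_mul1l V (f : 'End(V)) : End_mul V \1%VF f = f.
Proof. by rewrite End_mulE comp_lfun1l. Qed.

Fact End_mul1r V (f : 'End(V)) : End_mul V f \1%VF = f.
Proof. by rewrite End_mulE comp_lfun1r. Qed.

Fact End_mul_even V : @even_bilin K (hom_svect V V) (hom_svect V V) (hom_svect V V) (End_mul V).
Proof.
move=> i j f g /hom_partP fi /hom_partP gj; apply/hom_partP => l v vl.
by rewrite End_mulE comp_lfunE -addbA; exact/fi/gj.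
Qed.

Fact End_one_even V : (\1%VF : 'End(V)) \in part (hom_svect V V) false.
Proof. by apply/hom_partP => j v vj; rewrite id_lfunE. Qed.

Definition End_salg V : salg K :=
  @SAlg K (hom_svect V V) (End_mul V) \1%VF (@End_mulA V) (@End_mul1l V)
    (@End_mul1r V) (@End_mul_even V) (End_one_even V).

Lemma End_salg_simple V : (exists v : V, v != 0) -> simple_salg (End_salg V).
Proof.
move=> [v0 v00]; split.
  move=> /= /lfunP/(_ v0); rewrite id_lfunE zero_lfunE => v0E.
  by rewrite v0E eqxx in v00.
move=> I [Il Ir _]; have [->|I0] := eqVneq I 0%VS; [by left|right].
apply/eqP; rewrite eqEsubv subvf; apply/subvP => g _.
apply: (@End_ideal_full K V (fun f => f \in I) _ _ _ _ (vpick I)).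
- exact: mem0v.
- by move=> f h fI hI; rewrite memvD.
- by move=> f h fI; rewrite -End_mulE; exact: Il.
- by move=> f h fI; rewrite -End_mulE; exact: Ir.
- by rewrite vpick0.
- exact: memv_pick.
Qed.

Lemma simple_semisimple (A : salg K) : simple_salg A -> semisimple_salg A.
Proof.
move=> As; exists 1, (fun=> A), (fun=> \1%VF); split=> // [_|b].
  by split=> [i v|| a b]; rewrite ?id_lfunE.
exists (b ord0); split=> [i|a /(_ ord0)]; rewrite id_lfunE //.
by rewrite (ord1 i).
Qed.

End HomSpaces.

Section Opposite.
Variable K : numFieldType.
Implicit Types A : salg K.

(** The product [(-1)^(|a||b|) b a] of the opposite super algebra. *)
Definition op_mulf A (a b : A) : A :=
  smul A (hproj A false b) a + smul A (hproj A true b) (tw A true a).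

Definition op_mul A : 'Hom(A, 'Hom(A, A)) := bilfun (@op_mulf A).

Lemma op_mul_def A a b : op_mul A a b = op_mulf a b.
Proof.
rewrite /op_mul bilfunE // => [v c x y|v c x y]; rewrite /op_mulf.
  rewrite linearP [tw A true _]linearP linearP /= scalerDr.
  by rewrite addrACA.
rewrite [hproj A _ (_ + _)]linearP [hproj A _ (_ + _)]linearP /= !bilDl !bilZl scalerDr.
by rewrite addrACA.
Qed.

Lemma op_mulE A j a b : b \in part A j -> op_mul A a b = smul A b (tw A j a).
Proof.
move=> bj; rewrite op_mul_def /op_mulf !(hproj_homog _ bj).
by case: j bj => _ /=; rewrite bil0l ?add0r ?addr0 ?tw0.
Qed.

Fact op_mul_even A : @even_bilin K A A A (op_mul A).
Proof.
move=> i j a b ai bj; rewrite (op_mulE _ bj) addbC.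
exact/smul_even/tw_part.
Qed.

Fact op_mulA A a b c : op_mul A a (op_mul A b c) = op_mul A (op_mul A a b) c.
Proof.
elim/homogeneous_ind: c => [u v IHu IHv|k c ck]; first by rewrite !linearD /= IHu IHv.
elim/homogeneous_ind: b => [u v IHu IHv|j b bj].
  by rewrite !(bilDl, bilDr) IHu IHv.
rewrite (op_mulE _ bj) !(op_mulE _ ck) (op_mulE (j := k (+) j)); last first.
  exact/smul_even/tw_part.
by rewrite tw_smul tw_tw smulA.
Qed.

Fact op_mul1l A a : op_mul A (sone A) a = a.
Proof.
elim/homogeneous_ind: a => [u v IHu IHv|k c ck]; first by rewrite linearD /= IHu IHv.
by rewrite (op_mulE _ ck) tw_sone smul1r.
Qed.

Fact op_mul1r A a : op_mul A a (sone A) = a.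
Proof. by rewrite (op_mulE _ (sone_even A)) tw0 smul1l. Qed.

Definition op_salg A : salg K :=
  SAlg (@op_mulA A) (@op_mul1l A) (@op_mul1r A) (@op_mul_even A) (sone_even A).

Lemma op_salg_simple A : simple_salg A -> simple_salg (op_salg A).
Proof.
move=> [A1 As]; split=> // I [Il Ir Igr]; apply: As; split=> // a x xI.
  have: x \in (I :&: part A false + I :&: part A true)%VS by rewrite {1}Igr in xI.
  have h j y : y \in (I :&: part A j)%VS -> smul A a y \in I.
    move=> /memv_capP[yI yj].
    elim/homogeneous_ind: a => [u v IHu IHv|i a ai]; first by rewrite bilDl memvD.
    have := Ir (a) (tw A i y).
    rewrite /= (op_mulE _ ai) twK; apply.
    by rewrite (twE _ yj) memvZ.
  by move=> /memv_addP[y /h y0 [z /h z1 ->]]; rewrite linearD memvD.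
have: x \in (I :&: part A false + I :&: part A true)%VS by rewrite {1}Igr in xI.
have h j y : y \in (I :&: part A j)%VS -> smul A y a \in I.
  move=> /memv_capP[yI yj].
  by have := Il (tw A j a) y yI; rewrite /= (@op_mulE A _ _ _ yj) twK.
by move=> /memv_addP[y /h y0 [z /h z1 ->]]; rewrite bilDl memvD.
Qed.

(** [A (x) A^op] acts on [A] by [m |-> (-1)^(|b||m|) a m b]. *)
Definition two_sidedf A (a b m : A) : A :=
  smul A (smul A a m) (hproj A false b) + smul A (smul A a (tw A true m)) (hproj A true b).

Definition two_sided A : 'Hom(A, 'Hom(A, 'End(A))) :=
  bilfun (fun a b => linfun (@two_sidedf A a b)).

Lemma two_sided_def A a b m : two_sided A a b m = two_sidedf a b m.
Proof.
have fl a' b' : linear (@two_sidedf A a' b').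
  move=> c x y; rewrite /two_sidedf [tw _ _ _]linearP /= !bilDr !bilZr.
  by rewrite !(bilDl (smul A)) !bilZl addrACA scalerDr.
rewrite /two_sided bilfunE; first by rewrite linfunP.
  move=> v c x y; apply/lfunP => z; rewrite add_lfunE scale_lfunE !linfunP //.
  by rewrite /two_sidedf !(bilDl (smul A)) !bilZl addrACA scalerDr.
move=> v c x y; apply/lfunP => z; rewrite add_lfunE scale_lfunE !linfunP //.
rewrite /two_sidedf [hproj _ _ (_ + _)]linearP [hproj _ _ (_ + _)]linearP /= !bilDr !bilZr.
by rewrite addrACA scalerDr.
Qed.

Lemma two_sidedE A j a b m : b \in part A j ->
  two_sided A a b m = smul A (smul A a (tw A j m)) b.
Proof.
move=> bj; rewrite two_sided_def /two_sidedf !(hproj_homog _ bj).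
by case: j bj => _ /=; rewrite bil0r ?add0r ?addr0 ?tw0.
Qed.

End Opposite.

(** * A central simple super algebra and its opposite *)

Section TwoSided.
Variable K : numFieldType.
Implicit Types A : salg K.

Lemma two_sided_even A : @even_bilin K A (op_salg A) (End_salg A) (two_sided A).
Proof.
move=> i j a b ai bj; apply/hom_partP => l m ml.
rewrite (@two_sidedE _ A _ _ _ _ bj) addbAC.
exact/smul_even/bj/smul_even/tw_part.
Qed.

Lemma two_sided1 A : two_sided A (sone A) (sone A) = \1%VF.
Proof.
apply/lfunP => m; rewrite (two_sidedE _ _ (sone_even A)) id_lfunE tw0.
by rewrite smul1l smul1r.
Qed.

Lemma two_sidedM A i j (a b a' b' : A) : b \in part A i -> a' \in part A j ->
  (two_sided A a b \o two_sided A a' b')%VF =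
  (-1) ^+ (i && j) *: two_sided A (smul A a a') (op_mul A b b').
Proof.
move=> bi aj.
elim/homogeneous_ind: b' => [u v IHu IHv|l b' bl].
  by rewrite !bilDr comp_lfunDr IHu IHv scalerDr.
apply/lfunP => m; rewrite comp_lfunE scale_lfunE (two_sidedE _ _ bl).
rewrite (two_sidedE _ _ bi) (op_mulE _ bl) (two_sidedE (j := i (+) l)); last first.
  by rewrite addbC; exact/smul_even/tw_part.
rewrite !tw_smul tw_tw (twE _ aj) (twE _ bl) (twE _ bi).
rewrite !(bilZl (smul A), bilZr (smul A)) !scalerA !smulA; congr (_ *: _).
by rewrite [l && i]andbC mulrC andbC.
Qed.

(** The components of [x] are the averages of [x] with plus or minus [tw true x]. *)
Lemma graded_of_tw A (I : {vspace A}) : (forall x, x \in I -> tw A true x \in I) ->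
  (I = (I :&: part A false) + (I :&: part A true))%VS.
Proof.
move=> It; apply/eqP; rewrite eqEsubv subv_add !capvSl !andbT; apply/subvP => x xI.
have tE : tw A true x = hproj A false x - hproj A true x.
  by rewrite tw_unfold /tw_def add_lfunE opp_lfunE.
have two (v : A) : v + v \in I -> v \in I.
  move=> vI; have -> : v = 2^-1 *: (v + v); last exact: memvZ.
  by rewrite -mulr2n -[v *+ 2]scaler_nat scalerA mulVf ?scale1r // pnatr_eq0.
rewrite (hprojD x); apply: memv_add; apply/memv_capP; split; try exact: hproj_in.
  apply: two; have -> : hproj A false x + hproj A false x = x + tw A true x.
    by rewrite tE {3}(hprojD x) addrACA subrr addr0.
  by rewrite memvD ?It.
apply: two; have -> : hproj A true x + hproj A true x = x - tw A true x.
  by rewrite tE {3}(hprojD x) opprB [hproj A false x + _]addrC addrACA subrr addr0.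
by rewrite memvB ?It.
Qed.

(** Such a [z] satisfies [z z = - z z], hence [z z = 0], and [A z] is a graded
    ideal; if it contained 1 then [1 = a z] would give [z = a z z = 0]. *)
Lemma odd_supercentral0 A z : simple_salg A -> z \in part A true ->
  (forall c, smul A c z = smul A z (tw A true c)) -> z = 0.
Proof.
move=> [/eqP A1 As] z1 zC.
have zz : smul A z z = 0.
  have := zC z; rewrite (twE _ z1) expr1 scaleN1r linearN => /eqP.
  by rewrite -addr_eq0 -mulr2n -scaler_nat scaler_eq0 pnatr_eq0 /= => /eqP.
pose f := rmul z; have fE c : f c = smul A c z := rmulE c z.
have [I0|IF] : limg f = 0%VS \/ limg f = fullv.
- apply: As; split.
  + move=> a _ /memv_imgP[c _ ->]; apply/memv_imgP; exists (smul A a c).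
      exact: memvf.
    by rewrite !fE smulA.
  + move=> a _ /memv_imgP[c _ ->]; apply/memv_imgP; exists (smul A c (tw A true a)).
      exact: memvf.
    by rewrite !fE -!smulA zC twK.
  + apply: graded_of_tw => _ /memv_imgP[c _ ->]; apply/memv_imgP.
    exists (- tw A true c); first exact: memvf.
    by rewrite !fE tw_smul [tw A true z](twE _ z1) expr1 scaleN1r linearN linearN opp_lfunE.
- have : f (sone A) \in limg f by rewrite memv_img ?memvf.
  by rewrite fE smul1l I0 memv0 => /eqP.
have : sone A \in limg f by rewrite IF memvf.
move=> /memv_imgP[a _ aE].
by rewrite -[z]smul1l aE fE -smulA zz linear0.
Qed.

(** Injectivity of [A (x) A^op -> End A], by induction on the number of [b_i].
    The leading coefficients [w_0] of the relations [sum_i w_i (x) b_i = 0] form a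
    graded ideal.  If it is zero, the induction hypothesis applies.  Otherwise some
    relation has leading coefficient 1; its supercommutators with elements of [A]
    are relations with leading coefficient 0, so they vanish, and all its
    coefficients are supercentral, hence scalars.  Evaluating at 1 gives a
    linear relation among the [b_i] with leading coefficient 1. *)
Lemma two_sided_indep A : central_simple A ->
  forall n (d : 'I_n -> bool) (b : 'I_n -> A),
  (forall i, b i \in part A (d i)) ->
  (forall l : 'I_n -> K, \sum_i l i *: b i = 0 -> forall i, l i = 0) ->
  forall w : 'I_n -> A, \sum_i two_sided A (w i) (b i) = 0 -> forall i, w i = 0.
Proof.
move=> [Ac As]; elim=> [|n IHn] d b bd bfree w wR i; first by case: i.
pose Rel (w : 'I_n.+1 -> A) := \sum_i two_sided A (w i) (b i) = 0.
have RelE v : Rel v <-> forall m, \sum_i smul A (smul A (v i) (tw A (d i) m)) (b i) = 0.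
  split=> [vR m|vR].
    have /lfunP/(_ m) := vR; rewrite sum_lfunE zero_lfunE; apply: etrans.
    by apply: eq_bigr => j _; rewrite (two_sidedE _ _ (bd j)).
  apply/lfunP => m; rewrite sum_lfunE zero_lfunE; apply: etrans (vR m).
  by apply: eq_bigr => j _; rewrite (two_sidedE _ _ (bd j)).
have step v : Rel v -> v ord0 = 0 -> forall j, v j = 0.
  move=> vR v0; have v' := IHn (d \o lift ord0) (b \o lift ord0).
  move=> j; have [k ->|->//] := unliftP ord0 j.
  apply: (v' _ _ (v \o lift ord0)) => [k'|l lb|] /=; first exact: bd.
    pose l' (j : 'I_n.+1) := if unlift ord0 j is Some k then l k else 0.
    have := bfree l'; rewrite big_ord_recl {1}/l' unlift_none scale0r add0r.
    rewrite (eq_bigr (fun i => l i *: (b \o lift ord0) i)) => [/(_ lb) l0 k'|k' _].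
      by have := l0 (lift ord0 k'); rewrite /l' liftK.
    by rewrite /l' liftK.
  by move: vR; rewrite /Rel big_ord_recl v0 bil0l add0r.
have Rlin c u v : Rel u -> Rel v -> Rel (fun i => c *: u i + v i).
  rewrite /Rel => uR vR.
  rewrite (eq_bigr (fun i => c *: two_sided A (u i) (b i) + two_sided A (v i) (b i))).
    by rewrite big_split -scaler_sumr /= uR vR scaler0 addr0.
  by move=> j _; rewrite bilDl bilZl.
have Rl c v : Rel v -> Rel (fun i => smul A c (v i)).
  move=> /RelE vR; apply/RelE => m; rewrite -[RHS](linear0 (smul A c)) -[in RHS](vR m).
  by rewrite linear_sum; apply: eq_bigr => j _ /=; rewrite !smulA.
(* Substituting [c m] for [m] multiplies [v i] by a twist of [c]. *)
have Rr c v : Rel v -> Rel (fun i => smul A (v i) (tw A (d i) c)).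
  move=> /RelE vR; apply/RelE => m; apply: etrans (vR (smul A c m)).
  by apply: eq_bigr => j _; rewrite tw_smul !smulA.
(* Apply the grading automorphism to the relation; the sign is normalized so that
   the leading coefficient 1 is preserved. *)
have Rt v : Rel v -> Rel (fun i => (-1) ^+ (d i (+) d ord0) *: tw A true (v i)).
  move=> /RelE vR; apply/RelE => m.
  have := vR (tw A true m) => /(congr1 (fun x => (-1) ^+ d ord0 *: tw A true x)).
  rewrite linear0 scaler0 linear_sum scaler_sumr; apply: etrans.
  apply: eq_bigr => j _ /=.
  have -> : smul A (smul A (v j) (tw A (d j) (tw A true m))) (b j) =
            smul A (smul A (v j) (tw A true (tw A (d j) m))) (b j).
    by rewrite !tw_tw addbC.
  rewrite !tw_smul twK (twE _ (bd j)) andbT.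
  rewrite !(bilZl (smul A)) (bilZr (smul A)) scalerA; congr (_ *: _).
  by rewrite signr_addb mulrC.
have [I IE] : exists I : {vspace A}, forall x, x \in I <->
    exists v, Rel v /\ v ord0 = x.
  apply: vspace_of_pred => [|c _ _ [u [uR <-]] [v [vR <-]]].
    exists (fun=> 0); split=> //; rewrite /Rel big1 // => j _.
    by rewrite bil0l.
  by exists (fun j => c *: u j + v j); split=> //; exact: Rlin.
have [I0|IF] : I = 0%VS \/ I = fullv.
- apply: As.2; split=> [a x /IE[v [vR <-]]|a x /IE[v [vR <-]]|].
  + by apply/IE; exists (fun i => smul A a (v i)); split=> //; exact: Rl.
  + apply/IE; exists (fun i => smul A (v i) (tw A (d i) (tw A (d ord0) a))).
    by split; [exact: Rr|rewrite twK].
  + apply: graded_of_tw => _ /IE[v [vR <-]]; apply/IE.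
    exists (fun i => (-1) ^+ (d i (+) d ord0) *: tw A true (v i)).
    by split; [exact: Rt|rewrite addbb expr0 scale1r].
- apply: step i => //; apply/eqP; rewrite -memv0 -I0; apply/IE.
  by exists w.
have /IE[v [vR v1]] : sone A \in I by rewrite IF memvf.
(* The relation [c v - v c], twisted on the right, has leading coefficient 0. *)
have vC j c : smul A c (v j) = smul A (v j) (tw A (d j (+) d ord0) c).
  have := step (fun j => (-1) *: smul A (v j) (tw A (d j) (tw A (d ord0) c)) + smul A c (v j)).
  rewrite v1 smul1l smul1r twK scaleN1r addNr => /(_ _ erefl j) H.
  apply/eqP; rewrite -subr_eq0 addrC -tw_tw -scaleN1r; apply/eqP/H.
  by apply: Rlin; [exact: Rr|exact: Rl].
have vt j : v j \in part A (d j (+) d ord0).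
  apply/part_twP.
  have := step (fun j => (-1) *: v j + (-1) ^+ (d j (+) d ord0) *: tw A true (v j)).
  rewrite v1 addbb expr0 scale1r tw_sone scaleN1r addNr => /(_ _ erefl j) H.
  have /eqP := H (Rlin _ _ _ vR (Rt _ vR)).
  rewrite scaleN1r addrC subr_eq0 => /eqP {2}<-.
  by rewrite scalerA -expr2 sqrr_sign scale1r.
have vS j : exists c : K, v j = c *: sone A.
  have := vC j; have := vt j; case: (d j (+) d ord0) => vj vjC.
    by exists 0; rewrite scale0r; exact: odd_supercentral0 vjC.
  by apply/Ac; split=> // a; rewrite [RHS]vjC tw0.
have [l lE] := choice vS.
have l0 : forall j, l j = 0.
  apply: bfree; have /RelE/(_ (sone A)) := vR; apply: etrans.
  apply: eq_bigr => j _.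
  by rewrite tw_sone smul1r lE bilZl smul1l.
by have := As.1; rewrite -v1 lE l0 scale0r.
Qed.

Lemma homogeneous_basis (V : svect K) :
  exists (d : 'I_(dim V) -> bool) (b : 'I_(dim V) -> V),
    [/\ forall i, b i \in part V (d i),
        forall l : 'I_(dim V) -> K, \sum_i l i *: b i = 0 -> forall i, l i = 0
      & forall v, exists l : 'I_(dim V) -> K, v = \sum_i l i *: b i].
Proof.
pose X := vbasis (part V false) ++ vbasis (part V true).
have Xb : basis_of fullv X.
  rewrite -(part_sum V); apply: cat_basis; try exact: vbasisP.
  by apply/directv_addP; exact: part_cap.
have sX : size X == dim V.
  by rewrite -dimvf (size_basis (X := in_tuple X) Xb).
pose T := Tuple sX; have Tb : basis_of fullv T by [].
exists (fun i => \dim (part V false) <= i)%N, (fun i => T`_i); split=> [i|l lT i|v].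
- rewrite /= nth_cat size_tuple ltnNge.
  have iX : (i < size X)%N by rewrite (eqP sX).
  case: leqP => /= iV.
    apply: vbasis_mem; rewrite mem_nth // size_tuple ltn_subLR //.
    by move: iX; rewrite size_cat !size_tuple.
  by apply: vbasis_mem; rewrite mem_nth // size_tuple.
- by move/freeP: (basis_free Tb) => /(_ l lT).
- exists (fun i => coord T i v).
  exact: coord_basis Tb (memvf v).
Qed.

(** For a homogeneous basis [b] of [A], independence makes
    [w |-> sum_i two_sided w_i b_i] an injection from [A^n] to [End A], hence a
    bijection as both sides have dimension [n^2]; a bilinear map [s] extends along
    it as [w |-> sum_i s w_i b_i]. *)
Lemma two_sided_tensor A : central_simple A ->
  @is_graded_tensor K A (op_salg A) (End_salg A) (two_sided A).
Proof.
move=> Acs; split; first exact: two_sided_even.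
- exact: two_sided1.
- by move=> i j a b a' b' bi aj; rewrite /= End_mulE; exact: two_sidedM.
move=> W s.
have [d [b [bd bfree bspan]]] := homogeneous_basis A.
pose Phi (w : {ffun 'I_(dim A) -> A}) : 'End(A) := \sum_i two_sided A (w i) (b i).
have PhiL : linear Phi.
  move=> c u v; rewrite /Phi scaler_sumr -big_split; apply: eq_bigr => i _ /=.
  by rewrite !ffunE bilDl bilZl.
pose F := linfun Phi; have FE w : F w = Phi w by rewrite linfunP.
have Fi : injective F.
  apply/lker0P; rewrite -subv0; apply/subvP => w; rewrite memv_ker memv0 FE => /eqP w0.
  apply/eqP/ffunP => i; rewrite ffunE.
  exact: (two_sided_indep Acs bd bfree w0 i).
have Fb : bijective F.
  by apply: inj_dim_bij Fi _; rewrite dim_End [leqRHS]/dim /= card_ord.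
pose G (w : {ffun 'I_(dim A) -> A}) : W := \sum_i s (w i) (b i).
have GL : linear G.
  move=> c u v; rewrite /G scaler_sumr -big_split; apply: eq_bigr => i _ /=.
  by rewrite !ffunE bilDl bilZl.
have fE (a a' : A) : ((linfun G \o F^-1) (two_sided A a a'))%VF = s a a'.
  have [l ->] := bspan a'.
  pose w : {ffun 'I_(dim A) -> A} := [ffun i => l i *: a].
  have -> : two_sided A a (\sum_i l i *: b i) = F w.
    rewrite FE /Phi linear_sum; apply: eq_bigr => i _.
    by rewrite ffunE bilZl linearZ.
  rewrite comp_lfunE bij_lfunK // linfunP // /G linear_sum; apply: eq_bigr => i _.
  by rewrite ffunE bilZl linearZ.
exists (linfun G \o F^-1)%VF; split=> [a a'|g gE]; first exact: fE.
apply/lfunP => x; rewrite -[x](bij_lfunVK Fb) FE /Phi !linear_sum.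
by apply: eq_bigr => i _; apply: etrans (fE _ _) (esym (gE _ _)).
Qed.

End TwoSided.

(** * Endomorphism algebras are Morita trivial *)

Section Morita.
Variable K : numFieldType.
Implicit Types (A : salg K) (V : svect K).
Notation k := (ground_salg K).

Definition scale_right V : 'Hom(V, 'Hom(k, V)) :=
  bilfun (fun (v : V) (c : k) => (c : K) *: v).

Lemma scale_rightE V v c : scale_right V v c = (c : K) *: v.
Proof.
rewrite /scale_right bilfunE // => [d a x y|d a x y].
  by rewrite scalerDr !scalerA mulrC.
by rewrite scalerDl scalerA.
Qed.

Definition scale_left V : 'Hom(k, 'Hom(V, V)) :=
  bilfun (fun (c : k) (v : V) => (c : K) *: v).

Lemma scale_leftE V v c : scale_left V c v = (c : K) *: v.
Proof.
rewrite /scale_left bilfunE // => [d a x y|d a x y].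
  by rewrite scalerDl scalerA.
by rewrite scalerDr !scalerA mulrC.
Qed.

Lemma ground_smulE (c d : k) : smul k c d = (c : K) * (d : K).
Proof. exact: ground_mulE. Qed.

Lemma ground_part i (c : k) : c \in part k i -> c = 0 \/ i = false.
Proof. by case: i => /=; [rewrite memv0 => /eqP; left|right]. Qed.

Lemma scale_right_even V : even_bilin (scale_right V).
Proof.
move=> i j v c vi cj; rewrite scale_rightE.
by case: (ground_part cj) => ->; rewrite ?scale0r ?mem0v // addbF memvZ.
Qed.

Lemma scale_left_even V : even_bilin (scale_left V).
Proof.
move=> i j c v ci vj; rewrite scale_leftE.
by case: (ground_part ci) => ->; rewrite ?scale0r ?mem0v // addFb memvZ.
Qed.

Section StdBimod.
Variable V : svect K.

Definition std_act : 'Hom(End_salg V, 'Hom(V, V)) := \1%VF.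

Lemma std_actE f v : std_act f v = (f : 'End(V)) v.
Proof. by rewrite id_lfunE. Qed.

Fact std_lact1 m : std_act (sone (End_salg V)) m = m.
Proof. by rewrite std_actE id_lfunE. Qed.
Fact std_lactM a a' m : std_act (smul (End_salg V) a a') m = std_act a (std_act a' m).
Proof. by rewrite !std_actE /= End_mulE comp_lfunE. Qed.
Fact std_ract1 (m : V) : scale_right V m (sone k) = m.
Proof. by rewrite scale_rightE scale1r. Qed.
Fact std_ractM (m : V) b b' :
  scale_right V m (smul k b b') = scale_right V (scale_right V m b) b'.
Proof. by rewrite !scale_rightE ground_smulE scalerA mulrC. Qed.
Fact std_lractA a (m : V) b :
  std_act a (scale_right V m b) = scale_right V (std_act a m) b.
Proof. by rewrite !std_actE !scale_rightE linearZ. Qed.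
Fact std_act_even : even_bilin std_act.
Proof. by move=> i j f v /hom_partP fi vj; rewrite std_actE; exact: fi. Qed.

Definition std_bimod : sbimod (End_salg V) k :=
  SBimod std_lact1 std_lactM std_ract1 std_ractM std_lractA
    std_act_even (@scale_right_even V).

Definition dual_svect : svect K := hom_svect V (ground_svect K).

Definition dual_act : 'Hom(dual_svect, 'Hom(End_salg V, dual_svect)) :=
  bilfun (fun (phi : 'Hom(V, K^o)) (f : 'End(V)) => (phi \o f)%VF).

Lemma dual_actE phi f : dual_act phi f = ((phi : 'Hom(V, K^o)) \o (f : 'End(V)))%VF.
Proof.
rewrite /dual_act bilfunE // => [d a x y|d a x y].
  by rewrite comp_lfunDl -comp_lfunZl.
by rewrite comp_lfunDr -comp_lfunZr.
Qed.

Fact dual_lact1 m : scale_left dual_svect (sone k) m = m.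
Proof. by rewrite scale_leftE scale1r. Qed.
Fact dual_lactM a a' m : scale_left dual_svect (smul k a a') m =
  scale_left dual_svect a (scale_left dual_svect a' m).
Proof. by rewrite !scale_leftE ground_smulE scalerA. Qed.
Fact dual_ract1 m : dual_act m (sone (End_salg V)) = m.
Proof. by rewrite dual_actE comp_lfun1r. Qed.
Fact dual_ractM m b b' :
  dual_act m (smul (End_salg V) b b') = dual_act (dual_act m b) b'.
Proof. by rewrite !dual_actE /= End_mulE comp_lfunA. Qed.
Fact dual_lractA a m b : scale_left dual_svect a (dual_act m b) =
  dual_act (scale_left dual_svect a m) b.
Proof. by rewrite !dual_actE !scale_leftE -comp_lfunZl. Qed.
Fact dual_act_even : even_bilin dual_act.
Proof.
move=> i j f g /hom_partP fi /hom_partP gj; apply/hom_partP => l v vl.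
by rewrite dual_actE comp_lfunE -addbA; exact/fi/gj.
Qed.

Definition dual_bimod : sbimod k (End_salg V) :=
  SBimod dual_lact1 dual_lactM dual_ract1 dual_ractM dual_lractA
    (@scale_left_even dual_svect) dual_act_even.

Definition std_dual_tensor : 'Hom(std_bimod, 'Hom(dual_bimod, End_salg V)) :=
  bilfun (fun (v : V) (phi : 'Hom(V, K^o)) => rank1 v phi).

Lemma std_dual_tensorE v phi : std_dual_tensor v phi = rank1 v phi.
Proof.
rewrite /std_dual_tensor bilfunE // => [p c x y|p c x y]; apply/lfunP => u.
  by rewrite add_lfunE scale_lfunE !rank1E scalerDr !scalerA mulrC.
rewrite add_lfunE scale_lfunE !rank1E add_lfunE scale_lfunE scalerDl.
by rewrite scalerA.
Qed.

(** Since [f = sum_i f e_i (x) e_i^*] for a basis [e], a bilinear map [s] extends to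
    [End V] only as [f |-> sum_i s (f e_i) e_i^*]. *)
Lemma std_dual_rel_tensor :
  @is_rel_tensor K _ _ _ std_bimod dual_bimod (regular_sbimod (End_salg V))
    std_dual_tensor.
Proof.
split; first exact: balanced_ground.
- move=> i j v phi vi /hom_partP phij; apply/hom_partP => l u ul.
  rewrite std_dual_tensorE rank1E -addbA.
  case: (ground_part (phij _ _ ul)) => [->|->]; first by rewrite scale0r mem0v.
  by rewrite addbF memvZ.
- move=> f v phi; rewrite !std_dual_tensorE /= End_mulE id_lfunE.
  by apply/lfunP => u; rewrite comp_lfunE !rank1E linearZ.
- move=> v phi f; rewrite !std_dual_tensorE /= dual_actE End_mulE.
  by apply/lfunP => u; rewrite comp_lfunE !rank1E comp_lfunE.
move=> W s _.
pose e i := (vbasis (fullv : {vspace V}))`_i.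
pose F (f : 'End(V)) : W :=
  \sum_(i < \dim (fullv : {vspace V})) s (f (e i)) (dual_basis i).
have FL : linear F.
  move=> c f g; rewrite /F scaler_sumr -big_split; apply: eq_bigr => i _ /=.
  by rewrite add_lfunE scale_lfunE bilDl bilZl.
have FE v (phi : 'Hom(V, K^o)) : F (rank1 v phi) = s v phi.
  rewrite [in RHS](dual_sum phi) linear_sum; apply: eq_bigr => i _.
  by rewrite rank1E bilZl linearZ.
exists (linfun F); split=> [v phi|g gE].
  by rewrite std_dual_tensorE linfunP // FE.
apply/lfunP => f; rewrite linfunP // [in RHS](rank1_sum (f : 'End(V))) linear_sum.
by apply: eq_bigr => i _; apply/esym; rewrite -gE std_dual_tensorE.
Qed.

Definition dual_std_tensor : 'Hom(dual_bimod, 'Hom(std_bimod, k)) := \1%VF.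

Lemma dual_std_tensorE (phi : 'Hom(V, K^o)) v : dual_std_tensor phi v = phi v.
Proof. by rewrite id_lfunE. Qed.

(** Write [v = (v (x) phi0) v0] with [phi0 v0 = 1]; a balanced map then satisfies
    [s phi v = s (phi (v (x) phi0)) v0 = phi v *: s phi0 v0]. *)
Lemma dual_std_rel_tensor : (exists v : V, v != 0) ->
  @is_rel_tensor K _ _ _ dual_bimod std_bimod (regular_sbimod k) dual_std_tensor.
Proof.
move=> [v0 v00]; have [phi0 phi01] := exists_functional v00.
split.
- move=> phi f v; rewrite !dual_std_tensorE /= dual_actE id_lfunE.
  by rewrite comp_lfunE.
- by move=> i j phi v /hom_partP phii vj; rewrite dual_std_tensorE; exact: phii.
- by move=> c phi v; rewrite !lact_ground !dual_std_tensorE scale_lfunE.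
- by move=> phi v c; rewrite !ract_ground !dual_std_tensorE linearZ.
move=> W s sb.
have sE (phi : dual_bimod) (v : std_bimod) :
    s phi v = ((phi : 'Hom(V, K^o)) v : K) *: s phi0 v0.
  have {1}-> : v = lact std_bimod (rank1 v phi0) v0.
    by rewrite /= id_lfunE rank1E phi01 scale1r.
  rewrite -sb /= dual_actE -scale_lfunE -linearZ /=; congr (s _ v0).
  apply/lfunP => u; rewrite comp_lfunE rank1E scale_lfunE linearZ /=.
  exact: mulrC.
pose F (c : k) : W := (c : K) *: s phi0 v0.
have FL : linear F by move=> c x y; rewrite /F scalerDl scalerA.
exists (linfun F); split=> [phi v|g gE].
  by rewrite dual_std_tensorE linfunP // /F sE.
apply/lfunP => c; rewrite linfunP // /F -gE dual_std_tensorE phi01 -linearZ /=.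
by congr (g _); rewrite /GRing.scale /= mulr1.
Qed.

End StdBimod.

Lemma regular_rel_tensor A :
  @is_rel_tensor K _ _ _ (regular_sbimod A) (regular_sbimod A) (regular_sbimod A)
    (smul A).
Proof.
split.
- by move=> a b c /=; rewrite smulA.
- exact: smul_even.
- by move=> a b c /=; rewrite smulA.
- by move=> a b c /=; rewrite smulA.
move=> W s sb; exists (s (sone A)); split=> [a b|f fE].
  have := sb (sone A) a b; rewrite /= smul1l => ->; by [].
by apply/lfunP => a; rewrite -fE smul1l.
Qed.

Lemma sbimod_iso_refl (A B : salg K) (M : sbimod A B) : sbimod_iso M M.
Proof.
exists \1%VF; split; last by exists id => v; rewrite id_lfunE.
by split=> [i v|a m|m b]; rewrite !id_lfunE.
Qed.

(** The inverse of [A] is its opposite: [A (x) A^op = End A], which is Morita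
    equivalent to the ground field through [A] and its dual. *)
Lemma central_simple_invertible A : central_simple A -> invertible_salg A.
Proof.
move=> Acs; have A0 : exists v : A, v != 0 by exists (sone A); apply/eqP; exact: Acs.2.1.
exists (op_salg A), (End_salg A), (two_sided A); split; first exact: two_sided_tensor.
exists (std_bimod A), (dual_bimod A); split.
  exists (regular_sbimod (End_salg A)), (std_dual_tensor A).
  by split; [exact: std_dual_rel_tensor|exact: sbimod_iso_refl].
exists (regular_sbimod k), (dual_std_tensor A).
by split; [exact: dual_std_rel_tensor|exact: sbimod_iso_refl].
Qed.

End Morita.

(** * The topology of spaces of linear maps *)

Section LfunTopology.
Variable K : numFieldType.

Lemma mx_continuous (T : topologicalType) m n (h : T -> 'M[K]_(m, n)) :
  (forall i j, continuous (fun t => h t i j)) -> continuous h.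
Proof.
move=> hc t A [P Pn PA]; suff : \forall s \near t, forall ij, P ij.1 ij.2 (h s ij.1 ij.2).
  by apply: filterS => s Ps; apply: PA => i j; exact: (Ps (i, j)).
by apply: filter_forall => -[i j] /=; exact/hc/Pn.
Qed.

(** A functional is a linear combination of the matrix entries. *)
Lemma lfun_functional_continuous (V W : vectType K) (L : 'Hom('Hom(V, W), K^o)) :
  continuous (fun f : lfun_top V W => L f : K).
Proof.
pose E (j : 'I_(\dim (fullv : {vspace W}))) : W := (vbasis fullv)`_j.
have LE (f : 'Hom(V, W)) : L f =
    \sum_(i < \dim (fullv : {vspace V})) \sum_(j < \dim (fullv : {vspace W}))
      (lfun_mx f i j * (L (rank1 (E j) (dual_basis i)) : K)).
  rewrite {1}(rank1_sum f) linear_sum; apply: eq_bigr => i _ /=.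
  rewrite [f _](coord_vbasis (memvf _)).
  have -> : rank1 (\sum_j coord (vbasis fullv) j (f (vbasis fullv)`_i) *: E j)
        (dual_basis i) =
      \sum_j lfun_mx f i j *: rank1 (E j) (dual_basis i).
    apply/lfunP => v; rewrite rank1E sum_lfunE scaler_sumr; apply: eq_bigr => j _.
    by rewrite scale_lfunE rank1E mxE (tnth_nth 0) !scalerA mulrC.
  by rewrite linear_sum; apply: eq_bigr => j _; rewrite linearZ.
have -> : (fun f : lfun_top V W => L f : K) = fun f => \sum_i \sum_j
      (lfun_mx f i j * (L (rank1 (E j) (dual_basis i)) : K)).
  by apply/funext => f; exact: LE.
have sumC (n : nat) (g : 'I_n -> lfun_top V W -> K) :
    (forall i, continuous (g i)) -> continuous (fun f => \sum_i g i f).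
  elim: n g => [|n IHn] g gc.
    have -> : (fun f => \sum_i g i f) = (fun=> 0).
      by apply/funext => x; rewrite big_ord0.
    exact: cst_continuous.
  have -> : (fun f => \sum_i g i f) =
      (fun x => \sum_(i < n) g (widen_ord (leqnSn n) i) x + g ord_max x).
    by apply/funext => x; rewrite big_ord_recr.
  move=> f; apply: (@continuousD _ K^o); last exact: gc.
  by apply: (IHn (fun i => g (widen_ord (leqnSn n) i))) => i; exact: gc.
apply: (sumC _ _) => i; apply: (sumC _ _) => j f.
apply: (@continuousM _ _ (fun f : lfun_top V W => lfun_mx f i j)
  (fun=> L (rank1 (E j) (dual_basis i)) : K));
  last exact: cst_continuous.
apply: (@continuous_comp (lfun_top V W) _ _ (@lfun_mx K V W)
  (fun Z => Z i j)); first exact: initial_continuous.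
exact: coord_continuous.
Qed.

Lemma lfun_functional_open (V W : vectType K) (L : 'Hom('Hom(V, W), K^o)) :
  open [set f : lfun_top V W | (L f : K) != 0].
Proof.
have -> : [set f : lfun_top V W | (L f : K) != 0] =
    (fun f : lfun_top V W => L f : K) @^-1` ~` [set 0].
  by apply/seteqP; split=> f /= /eqP.
apply: open_comp => [f _|]; first exact: lfun_functional_continuous.
rewrite openC; apply: accessible_closed_set1; apply: hausdorff_accessible.
exact: norm_hausdorff.
Qed.

Lemma lfun_linear_continuous (V W V' W' : vectType K)
    (L : 'Hom('Hom(V, W), 'Hom(V', W'))) :
  continuous (fun f : lfun_top V W => L f : lfun_top V' W').
Proof.
apply: continuous_comp_initial; apply: mx_continuous => i j.
pose l : 'Hom('Hom(V, W), K^o) := linfun (fun f => coord (vbasis fullv) j (L f (tnth (vbasis fullv) i)) : K^o).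
rewrite (_ : (fun _ => _) = fun f => l f); first exact: lfun_functional_continuous.
apply/funext => f; rewrite /= mxE /l linfunP // => c g h.
by rewrite bilDl bilZl linearP.
Qed.

(** If [sec] is a section of [p] near [p s], continuous and passing through [s],
    then every point of the neighbourhood [sec @^-1` V] of [p s] is the image of a
    point of [V]. *)
Lemma open_map_of_sections (S T : topologicalType) (E : set S) (D : set T)
    (p : S -> T) (q : E -> D) : (forall e, set_val (q e) = p (set_val e)) ->
  (forall s, E s -> exists (sec : T -> S) (O : set T),
    [/\ continuous sec, sec (p s) = s, open O, O (p s)
      & forall t, D t -> O t -> E (sec t) /\ p (sec t) = t]) ->
  open_map q.
Proof.
move=> qE sections _ [V Vo <-].
rewrite openE => _ [e Ve <-]; rewrite /interior.
have [sec [Nb [secc secp Oo Op secE]]] := sections _ (set_mem (valP e)).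
pose N := Nb `&` sec @^-1` V.
have No : open N by apply: openI => //; move/continuousP: secc; exact.
have Ne : N (set_val (q e)).
  by rewrite qE; split=> //; rewrite /= secp.
have Nn : nbhs (q e) (set_val @^-1` N).
  by apply: (@initial_continuous D T set_val (q e)); exact: open_nbhs_nbhs.
apply: (filterS _ Nn) => t [Ot Vt].
have [Et pt] := secE _ (set_mem (valP t)) Ot.
exists (SigSub (mem_set Et)); first exact: Vt.
by apply: val_inj; rewrite -[LHS]/(set_val _) qE.
Qed.

End LfunTopology.

(** * Implementing bimodules *)

Section ImplementingBimodules.
Variable K : numFieldType.
Notation k := (ground_salg K).
Implicit Types (A B : salg K) (V : svect K).

Lemma pair_continuous (T U V : topologicalType) (f : T -> U) (g : T -> V) :
  continuous f -> continuous g -> continuous (fun x => (f x, g x)).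
Proof. by move=> fc gc x; exact: (cvg_pair (fc x) (gc x)). Qed.

Lemma ground_aut_id (f : 'End(k)) : salg_aut f -> f = \1%VF.
Proof.
move=> [[_ f1 _] _]; apply/lfunP => c; rewrite id_lfunE.
have cE : c = (c : K) *: sone k by rewrite /GRing.scale /= mulr1.
by rewrite cE linearZ /= -[X in f X]/(sone k) f1.
Qed.

Lemma mem_ImplS A B (M : sbimod A B) (phi : 'End(A)) (u : 'End(M)) (psi : 'End(B)) :
  salg_aut phi -> salg_aut psi -> even_map u -> bijective u ->
  (forall a m b, u (ract M (lact M a m) b) =
                 ract M (lact M (phi a) (u m)) (psi b)) ->
  @ImplS K A B M (phi, u, psi).
Proof. by split. Qed.

Lemma open_impl_projl_sections A B (M : sbimod A B) :
  (forall t, @ImplS K _ _ M t -> exists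
      (sec : lfun_top A A -> (lfun_top A A * lfun_top M M * lfun_top B B)%type)
      (O : set (lfun_top A A)),
    [/\ continuous sec, sec t.1.1 = t, open O, O t.1.1
      & forall f, @AutS K A f -> O f -> @ImplS K _ _ M (sec f) /\ (sec f).1.1 = f]) ->
  open_map (@impl_projl K A B M).
Proof.
exact: (@open_map_of_sections (lfun_top A A * lfun_top M M * lfun_top B B)%type
  (lfun_top A A) (@ImplS K A B M) (@AutS K A) (fun t => t.1.1) (@impl_projl K A B M)).
Qed.

Lemma open_impl_projr_sections A B (M : sbimod A B) :
  (forall t, @ImplS K _ _ M t -> exists
      (sec : lfun_top B B -> (lfun_top A A * lfun_top M M * lfun_top B B)%type)
      (O : set (lfun_top B B)),
    [/\ continuous sec, sec t.2 = t, open O, O t.2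
      & forall f, @AutS K B f -> O f -> @ImplS K _ _ M (sec f) /\ (sec f).2 = f]) ->
  open_map (@impl_projr K A B M).
Proof.
exact: (@open_map_of_sections (lfun_top A A * lfun_top M M * lfun_top B B)%type
  (lfun_top B B) (@ImplS K A B M) (@AutS K B) (fun t => t.2) (@impl_projr K A B M)).
Qed.

Lemma open_impl_projl_subsingleton A B (M : sbimod A B) :
  (forall f : 'End(A), salg_aut f -> f = \1%VF) -> open_map (@impl_projl K A B M).
Proof.
move=> A1; apply: open_impl_projl_sections => t tI.
exists (fun=> t), setT; split=> //; [exact: cst_continuous|exact: openT|].
by move=> f fA _; split=> //; case: tI => /A1 -> _ _ _ _; rewrite (A1 f fA).
Qed.

Lemma open_impl_projr_subsingleton A B (M : sbimod A B) :
  (forall f : 'End(B), salg_aut f -> f = \1%VF) -> open_map (@impl_projr K A B M).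
Proof.
move=> A1; apply: open_impl_projr_sections => t tI.
exists (fun=> t), setT; split=> //; [exact: cst_continuous|exact: openT|].
by move=> f fA _; split=> //; case: tI => _ /A1 -> _ _ _; rewrite (A1 f fA).
Qed.

Lemma even_functional V (v : V) : v \in part V false -> v != 0 ->
  exists phi : dual_svect V, phi \in part (dual_svect V) false /\
    (phi : 'Hom(V, K^o)) v = 1.
Proof.
move=> v0 /exists_functional[phi phi1]; exists (phi \o hproj V false)%VF; split.
  apply/hom_partP => j u uj; rewrite comp_lfunE (hproj_homog _ uj).
  by case: j uj => _ /=; rewrite ?linear0 ?mem0v ?memvf.
by rewrite comp_lfunE hproj_id.
Qed.

Lemma rank1_part V (W : svect K) i j (w : W) (phi : 'Hom(V, K^o)) :
  w \in part W i -> phi \in part (dual_svect V) j ->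
  rank1 w phi \in part (hom_svect V W) (i (+) j).
Proof.
move=> wi /hom_partP phij; apply/hom_partP => l u ul; rewrite rank1E -addbA.
case: (ground_part (phij _ _ ul)) => [->|->]; first by rewrite scale0r mem0v.
by rewrite addbF memvZ.
Qed.

(** An automorphism [phi] near [phi0] is implemented by
    [u w = phi (w (x) f0) (u0 v0)]: this is linear in [phi], equals [u0] at
    [phi0], and intertwines; being either zero or injective, it is invertible as
    soon as it does not vanish at [v0]. *)
Lemma std_implementing V (v0 : V) : v0 \in part V false -> v0 != 0 ->
  implementing_sbimod (std_bimod V).
Proof.
move=> v0e v00; split; last exact/open_impl_projr_subsingleton/ground_aut_id.
have [f0 [f0e f01]] := even_functional v0e v00.
apply: open_impl_projl_sections => -[[phi0 u0] psi0] [/= phi0A psi0A u0e u0b u0M].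
have u0E (f : End_salg V) (m : V) : u0 ((f : 'End(V)) m) = (phi0 f : 'End(V)) (u0 m).
  have := u0M f m (1 : K); rewrite (ground_aut_id psi0A).
  by rewrite !scale_rightE !std_actE id_lfunE !scale1r.
pose Uf (phi : 'End('End(V))) (w : V) : V := phi (rank1 w (f0 : 'Hom(V, K^o))) (u0 v0).
pose U : 'Hom('End('End(V)), 'End(V)) := bilfun Uf.
have UE phi w : U phi w = Uf phi w.
  rewrite /U bilfunE // => [x c p q|p c x y]; rewrite /Uf.
    by rewrite add_lfunE scale_lfunE add_lfunE scale_lfunE.
  have -> : rank1 (c *: x + y) (f0 : 'Hom(V, K^o)) = c *: rank1 x (f0 : 'Hom(V, K^o)) + rank1 y (f0 : 'Hom(V, K^o)).
    apply/lfunP => z; rewrite add_lfunE scale_lfunE !rank1E scalerDr.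
    by rewrite !scalerA mulrC.
  by rewrite linearP add_lfunE scale_lfunE.
have [g g1] : exists g : 'Hom(V, K^o), g (u0 v0) = 1.
  apply: exists_functional; apply: contra v00 => /eqP u00.
  by apply/eqP/(bij_inj u0b); rewrite u00 linear0.
pose L : 'Hom('End('End(V)), K^o) := linfun (fun phi => g (U phi v0)).
have LE phi : L phi = g (U phi v0).
  by rewrite /L linfunP // => c p q; rewrite bilDl bilZl linearP.
have U0 : U phi0 = u0.
  apply/lfunP => w; rewrite UE /Uf -u0E rank1E.
  by rewrite -[X in _ = u0 X]scale1r; congr (u0 (_ *: _)).
exists (fun phi : lfun_top (End_salg V) (End_salg V) =>
  ((phi, U phi), psi0) : (_ * lfun_top V V * lfun_top k k)%type).
exists [set phi : lfun_top (End_salg V) (End_salg V) | (L phi : K) != 0]; split.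
- apply: pair_continuous (@cst_continuous _ _ _).
  apply: (@pair_continuous _ (lfun_top _ _)); first by move=> x; exact: cvg_id.
  exact: lfun_linear_continuous.
- by rewrite /= U0.
- exact: lfun_functional_open.
- by rewrite /= LE U0 g1 oner_neq0.
move=> phi phiA Lphi; split=> //; have [[phie phi1 phiM] phib] := phiA.
have Uint (f : 'End(V)) (m : V) : U phi (f m) = (phi f : 'End(V)) (U phi m).
  have := phiM f (rank1 m (f0 : 'Hom(V, K^o))); rewrite /= !End_mulE.
  move=> /lfunP/(_ (u0 v0)); rewrite comp_lfunE !UE => <-.
  congr (fun_of_lfun (fun_of_lfun phi _) _).
  by apply/lfunP => x; rewrite comp_lfunE !rank1E linearZ.
apply: (mem_ImplS phiA psi0A).
- move=> i w wi; rewrite UE /Uf.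
  have /hom_partP/(_ false (u0 v0)) := phie _ _ (rank1_part wi f0e).
  by rewrite !addbF; apply; exact: u0e.
- (* If [U phi] kills a nonzero [w], it kills [f w] for all [f], so also [v0]. *)
  apply: inj_dim_bij => //; apply/lker0P; rewrite -subv0; apply/subvP => w.
  rewrite memv_ker memv0 => /eqP w0; apply: contraNT Lphi => /exists_functional[h h1].
  rewrite LE; have -> : v0 = rank1 v0 h w by rewrite rank1E h1 scale1r.
  by rewrite Uint w0 !linear0.
- move=> f m b; rewrite /= !scale_rightE (ground_aut_id psi0A) id_lfunE linearZ /=.
  by rewrite !id_lfunE Uint.
Qed.

(** Dually, [psi] near [psi0] is implemented by [u f = u0 f0 o psi (v0 (x) f)]. *)
Lemma dual_implementing V (v0 : V) : v0 \in part V false -> v0 != 0 ->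
  implementing_sbimod (dual_bimod V).
Proof.
move=> v0e v00; split; first exact/open_impl_projl_subsingleton/ground_aut_id.
have [f0 [f0e f01]] := even_functional v0e v00.
apply: open_impl_projr_sections => -[[phi0 u0] psi0] [/= phi0A psi0A u0e u0b u0M].
have u0E (f : 'Hom(V, K^o)) (T : 'End(V)) : u0 (f \o T)%VF =
    ((u0 f : 'Hom(V, K^o)) \o (psi0 T : 'End(V)))%VF.
  have M0 : forall a m b, u0 (ract (dual_bimod V) (lact (dual_bimod V) a m) b) =
      ract (dual_bimod V) (lact (dual_bimod V) (phi0 a) (u0 m)) (psi0 b) := u0M.
  have := M0 (1 : K) f T; rewrite (ground_aut_id phi0A) !lact_ground id_lfunE.
  by rewrite !scale1r /= !dual_actE.
pose Uf (psi : 'End('End(V))) (f : 'Hom(V, K^o)) : 'Hom(V, K^o) :=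
  ((u0 f0 : 'Hom(V, K^o)) \o psi (rank1 v0 f))%VF.
pose U : 'Hom('End('End(V)), 'End('Hom(V, K^o))) := bilfun Uf.
have UE psi f : U psi f = Uf psi f.
  rewrite /U bilfunE // => [x c p q|p c x y]; rewrite /Uf.
    by rewrite add_lfunE scale_lfunE comp_lfunDr -comp_lfunZr.
  have -> : rank1 v0 (c *: x + y) = c *: rank1 v0 x + rank1 v0 y.
    apply/lfunP => z; rewrite add_lfunE scale_lfunE !rank1E add_lfunE scale_lfunE.
    by rewrite scalerDl scalerA.
  by rewrite linearP /= comp_lfunDr -comp_lfunZr.
have [y0 y00] : exists y0, (u0 f0 : 'Hom(V, K^o)) y0 != 0.
  have /lfunPn[y] : (u0 f0 : 'Hom(V, K^o)) != 0.
    apply/eqP => u00; have f00 : f0 = 0 by apply: (bij_inj u0b); rewrite u00 linear0.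
    by have /eqP := f01; rewrite f00 zero_lfunE eq_sym oner_eq0.
  by rewrite zero_lfunE => ?; exists y.
pose L : 'Hom('End('End(V)), K^o) := linfun (fun psi => U psi f0 y0).
have LE psi : L psi = U psi f0 y0.
  by rewrite /L linfunP // => c p q; rewrite bilDl bilZl add_lfunE scale_lfunE.
have U0 : U psi0 = u0.
  apply/lfunP => f; rewrite UE /Uf -u0E; congr (u0 _).
  apply/lfunP => x; rewrite comp_lfunE rank1E linearZ /= f01.
  exact: mulr1.
exists (fun psi : lfun_top (End_salg V) (End_salg V) =>
  ((phi0, U psi), psi) : (lfun_top k k * lfun_top (dual_svect V) (dual_svect V) * _)%type).
exists [set psi : lfun_top (End_salg V) (End_salg V) | (L psi : K) != 0]; split.
- apply: (@pair_continuous _ _ (lfun_top _ _)); last by move=> x; exact: cvg_id.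
  apply: pair_continuous (@cst_continuous _ _ _) _.
  exact: lfun_linear_continuous.
- by rewrite /= U0.
- exact: lfun_functional_open.
- by rewrite /= LE U0.
move=> psi psiA Lpsi; split=> //; have [[psie psi1 psiM] psib] := psiA.
have Uint (f : 'Hom(V, K^o)) (T : 'End(V)) :
    U psi (f \o T)%VF = (U psi f \o (psi T : 'End(V)))%VF.
  have := psiM (rank1 v0 f) T; rewrite /= !End_mulE !UE /Uf -comp_lfunA => <-.
  congr (_ \o fun_of_lfun psi _)%VF.
  by apply/lfunP => x; rewrite comp_lfunE !rank1E comp_lfunE.
apply: (mem_ImplS phi0A psiA).
- move=> i f fi; rewrite UE /Uf; apply/hom_partP => j x xj; rewrite comp_lfunE.
  have /hom_partP/(_ j x xj) := psie _ _ (rank1_part v0e fi).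
  have /hom_partP u0f := u0e _ _ f0e.
  by move=> /u0f.
- apply: inj_dim_bij => //; apply/lker0P; rewrite -subv0; apply/subvP => f.
  rewrite memv_ker memv0 => /eqP w0; apply: contraNT Lpsi => fn0.
  have [x fx] : exists x, (f : 'Hom(V, K^o)) x != 0.
    have /lfunPn[x] := fn0; rewrite zero_lfunE => ?; by exists x.
  rewrite LE.
  pose c : K := (f : 'Hom(V, K^o)) x.
  have -> : f0 = ((f : 'Hom(V, K^o)) \o rank1 (c^-1 *: x) (f0 : 'Hom(V, K^o)))%VF.
    apply/lfunP => y; rewrite comp_lfunE rank1E !linearZ /=.
    by rewrite /GRing.scale /= mulVf ?mulr1.
  by rewrite Uint w0 comp_lfun0l zero_lfunE.
- move=> c f T; rewrite !lact_ground (ground_aut_id phi0A) id_lfunE /= !dual_actE.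
  by rewrite -comp_lfunZl linearZ /= Uint comp_lfunZl.
Qed.

Lemma even_inverse (V W : svect K) (u : 'Hom(V, W)) v i :
  even_map u -> bijective u -> u v \in part W i -> v \in part V i.
Proof.
move=> ue ub uv; rewrite [v](hprojD v).
have := uv; rewrite {1}(hprojD v) linearD => uD.
have z : u (hproj V (~~ i) v) = 0.
  apply/eqP; rewrite -memv0 -(part_capC W i); apply/memv_capP; split.
    have ui : u (hproj V i v) \in part W i by apply: ue; exact: hproj_in.
    move: uD; case: i {uv} ui => ui /=; last by rewrite rpredDl.
    by rewrite rpredDr.
  by apply: ue; exact: hproj_in.
have z' : hproj V (~~ i) v = 0 by apply: (bij_inj ub); rewrite z linear0.
by case: i z' {uv uD z} => /= ->; rewrite ?add0r ?addr0 hproj_in.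
Qed.

Definition conj_map A (c d : A) (phi : 'End(A)) : 'End(A) :=
  (smul A d \o rmul c \o phi)%VF.

Lemma conj_mapE A (c d : A) phi x :
  conj_map c d phi x = smul A d (smul A (phi x) c).
Proof. by rewrite /conj_map !comp_lfunE rmulE. Qed.

Lemma conj_map_aut A (c d : A) (phi : 'End(A)) : smul A c d = sone A ->
  smul A d c = sone A -> c \in part A false -> d \in part A false ->
  salg_aut phi -> salg_aut (conj_map c d phi).
Proof.
move=> cd dc ce de [[phie phi1 phiM] phib]; split.
  split=> [i v vi||a b]; rewrite !conj_mapE.
  - rewrite -(addFb i); apply: smul_even => //; rewrite -(addbF i).
    by apply: smul_even => //; exact: phie.
  - by rewrite phi1 smul1l dc.
  - by rewrite phiM -!smulA [smul A c (smul A d _)]smulA cd smul1l.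
have [h hK Kh] := phib.
exists (fun x => h (smul A c (smul A x d))) => x; rewrite conj_mapE.
  by rewrite -!smulA cd smul1r smulA cd smul1l hK.
by rewrite Kh -!smulA dc smul1r smulA dc smul1l.
Qed.

Lemma regular_impl A (c d : A) (phi psi : 'End(A)) : smul A c d = sone A ->
  smul A d c = sone A -> c \in part A false ->
  salg_aut phi -> salg_aut psi -> (forall x, psi x = conj_map c d phi x) ->
  @ImplS K _ _ (regular_sbimod A) (phi, (rmul c \o phi)%VF, psi).
Proof.
move=> cd dc ce phiA psiA psiE; have [[phie phi1 phiM] [h hK Kh]] := phiA.
split=> //=.
- move=> i v vi; rewrite comp_lfunE rmulE -(addbF i).
  by apply: smul_even => //; exact: phie.
- exists (fun x => h (smul A x d)) => x; rewrite comp_lfunE rmulE.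
    by rewrite -smulA cd smul1r hK.
  by rewrite Kh -smulA dc smul1r.
move=> a m b; rewrite psiE conj_mapE !comp_lfunE !rmulE !phiM.
by rewrite -!smulA [smul A c (smul A d _)]smulA cd smul1l.
Qed.

(** The elements of [I(A)] are the triples [(phi, phi(-) c, c^-1 phi(-) c)], [c] an
    even unit, so both projections have linear sections keeping [c] fixed. *)
Lemma regular_implementing A : implementing_sbimod (regular_sbimod A).
Proof.
have key (phi0 u0 psi0 : 'End(A)) : @ImplS K _ _ (regular_sbimod A) (phi0, u0, psi0) ->
    exists c d : A, [/\ smul A c d = sone A, smul A d c = sone A,
      c \in part A false, d \in part A false &
      (forall x, u0 x = smul A (phi0 x) c) /\ (forall x, u0 x = smul A c (psi0 x))].
  move=> [/= phi0A psi0A u0e u0b u0M]; pose c := u0 (sone A).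
  have [[phie phi1 _] _] := phi0A; have [[_ psi1 _] _] := psi0A.
  have uphi x : u0 x = smul A (phi0 x) c.
    by have := u0M x (sone A) (sone A); rewrite !smul1r psi1 smul1r.
  have upsi x : u0 x = smul A c (psi0 x).
    by have := u0M (sone A) (sone A) x; rewrite !smul1l phi1 smul1l.
  have [h hK Kh] := u0b; pose a := h (sone A).
  have dc : smul A (phi0 a) c = sone A by rewrite -uphi Kh.
  have cd' : smul A c (psi0 a) = sone A by rewrite -upsi Kh.
  have dE : phi0 a = psi0 a by rewrite -[LHS]smul1r -cd' smulA dc smul1l.
  exists c, (phi0 a); split=> //; first by rewrite dE.
    by apply: u0e; exact: sone_even.
  apply: phie; apply: (even_inverse u0e u0b).
  by rewrite Kh sone_even.
split.
  apply: open_impl_projl_sections => -[[phi0 u0] psi0] tI; have [c [d [cd dc ce de [uphi upsi]]]] := key _ _ _ tI.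
  pose U : 'Hom('End(A), 'End(A)) := linfun (fun phi => (rmul c \o phi)%VF).
  have UE phi : U phi = (rmul c \o phi)%VF.
    by rewrite /U linfunP // => x p q; rewrite comp_lfunDr -comp_lfunZr.
  pose P : 'Hom('End(A), 'End(A)) := linfun (conj_map c d).
  have PE phi : P phi = conj_map c d phi.
    by rewrite /P linfunP // => x p q; rewrite /conj_map comp_lfunDr -comp_lfunZr.
  exists (fun phi : lfun_top A A =>
    ((phi, U phi), P phi) : (_ * lfun_top A A * lfun_top A A)%type), setT; split=> //.
  - apply: pair_continuous; last exact: lfun_linear_continuous.
    apply: (@pair_continuous _ (lfun_top _ _)); first by move=> x; exact: cvg_id.
    exact: lfun_linear_continuous.
  - congr (_, _, _).
      by apply/lfunP => x; rewrite UE comp_lfunE rmulE uphi.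
    apply/lfunP => x; rewrite PE conj_mapE -uphi upsi smulA dc.
    exact: smul1l.
  - exact: openT.
  move=> phi phiA _; split=> //; rewrite UE PE; apply: (regular_impl cd dc) => //.
  exact: conj_map_aut.
apply: open_impl_projr_sections => -[[phi0 u0] psi0] tI; have [c [d [cd dc ce de [uphi upsi]]]] := key _ _ _ tI.
pose P : 'Hom('End(A), 'End(A)) := linfun (conj_map d c).
have PE psi : P psi = conj_map d c psi.
  by rewrite /P linfunP // => x p q; rewrite /conj_map comp_lfunDr -comp_lfunZr.
pose U : 'Hom('End(A), 'End(A)) := linfun (fun psi => (rmul c \o P psi)%VF).
have UE psi : U psi = (rmul c \o P psi)%VF.
  by rewrite /U linfunP // => x p q; rewrite linearP /= comp_lfunDr -comp_lfunZr.
exists (fun psi : lfun_top A A =>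
  ((P psi, U psi), psi) : (lfun_top A A * lfun_top A A * _)%type), setT; split=> //.
- apply: (@pair_continuous _ _ (lfun_top _ _)); last by move=> x; exact: cvg_id.
  by apply: pair_continuous; exact: lfun_linear_continuous.
- have P0 : P psi0 = phi0.
    apply/lfunP => x; rewrite PE conj_mapE smulA -upsi uphi -smulA cd.
    exact: smul1r.
  by congr (_, _, _) => //; apply/lfunP => x; rewrite UE P0 comp_lfunE rmulE uphi.
- exact: openT.
move=> psi psiA _; split=> //; rewrite UE PE; apply: (regular_impl cd dc) => //.
  exact: conj_map_aut.
move=> x; rewrite !conj_mapE -!smulA dc smul1r smulA dc.
by rewrite smul1l.
Qed.

End ImplementingBimodules.

(** * Smooth functions *)

Section SmoothFunctions.
Variable R : realType.

Section Euclidean.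
Variable n : nat.
Implicit Types (D : set 'rV[R]_n) (f g : 'rV[R]_n -> R).

Lemma Ck_cont k D f : Ck k D f -> forall x, D x -> {for x, continuous f}.
Proof. by case: k => [|k] []. Qed.

Lemma Ck_derivable k D f i : Ck k.+1 D f ->
  forall x, D x -> derivable f x (basis_vec R i).
Proof. by case=> _ /(_ i)[]. Qed.

Lemma Ck_deriv k D f i : Ck k.+1 D f -> Ck k D (fun x => 'D_(basis_vec R i) f x).
Proof. by case=> _ /(_ i)[]. Qed.

(** The definition of [Ck] constrains [f] and its derivatives pointwise. *)
Lemma Ck_local k D f :
  (forall x, D x -> exists2 D', D' x & Ck k D' f) -> Ck k D f.
Proof.
elim: k f => [|k IHk] f H; split=> //.
- by move=> x /H[D' D'x /Ck_cont]; exact.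
- by move=> x /H[D' D'x /Ck_cont]; exact.
move=> i; split; first by move=> x /H[D' D'x /Ck_derivable]; exact.
by apply: IHk => x /H[D' D'x Dk]; exists D' => //; exact: Ck_deriv.
Qed.

Lemma Ck_pred k D f : Ck k.+1 D f -> Ck k D f.
Proof.
elim: k f => [|k IHk] f [fc fd]; split=> // i.
by have [fd1 fd2] := fd i; split=> //; exact: IHk.
Qed.

Lemma near_open_eq D f g x : open D -> (forall y, D y -> f y = g y) -> D x ->
  \forall y \near x, f y = g y.
Proof. by move=> Do fg Dx; exact: (filterS fg (open_nbhs_nbhs (conj Do Dx))). Qed.

Lemma continuous_congr D f g x : open D -> (forall y, D y -> f y = g y) -> D x ->
  {for x, continuous f} -> {for x, continuous g}.
Proof.
move=> Do fg Dx; rewrite /prop_for /continuous_at -(fg _ Dx).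
have nfg : {near nbhs x, f =1 g} by exact: near_open_eq Do fg Dx.
by apply: cvg_trans; exact: (near_eq_cvg nfg).
Qed.

Lemma Ck_congr k D f g : open D -> (forall x, D x -> f x = g x) ->
  Ck k D f -> Ck k D g.
Proof.
move=> Do; elim: k f g => [|k IHk] f g fg fk; split=> //.
- by move=> x Dx; apply: (continuous_congr Do fg Dx); exact: Ck_cont fk _ Dx.
- by move=> x Dx; apply: (continuous_congr Do fg Dx); exact: Ck_cont fk _ Dx.
move=> i; have fd := Ck_derivable (i := i) fk; split=> [x Dx|].
  by apply: (near_eq_derivable (near_open_eq Do fg Dx)); exact: fd.
apply: IHk (Ck_deriv i fk) => x Dx.
by apply: near_eq_derive; exact: (near_open_eq Do fg Dx).
Qed.

Lemma Ck_add k D f g : open D -> Ck k D f -> Ck k D g -> Ck k D (fun x => f x + g x).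
Proof.
move=> Do; elim: k f g => [|k IHk] f g fk gk; split=> //.
- by move=> x Dx; apply: continuousD; [exact: Ck_cont fk _ Dx|exact: Ck_cont gk _ Dx].
- by move=> x Dx; apply: continuousD; [exact: Ck_cont fk _ Dx|exact: Ck_cont gk _ Dx].
move=> i; have fd := Ck_derivable (i := i) fk; have gd := Ck_derivable (i := i) gk.
split=> [x Dx|]; first by apply: derivableD; [exact: fd|exact: gd].
apply: Ck_congr (IHk _ _ (Ck_deriv i fk) (Ck_deriv i gk)) => // x Dx.
by apply/esym; apply: deriveD; [exact: fd|exact: gd].
Qed.

Lemma Ck_mul k D f g : open D -> Ck k D f -> Ck k D g -> Ck k D (fun x => f x * g x).
Proof.
move=> Do; elim: k f g => [|k IHk] f g fk gk; split=> //.
- by move=> x Dx; apply: continuousM; [exact: Ck_cont fk _ Dx|exact: Ck_cont gk _ Dx].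
- by move=> x Dx; apply: continuousM; [exact: Ck_cont fk _ Dx|exact: Ck_cont gk _ Dx].
move=> i; have fd := Ck_derivable (i := i) fk; have gd := Ck_derivable (i := i) gk.
split=> [x Dx|]; first by apply: derivableM; [exact: fd|exact: gd].
have := Ck_add Do (IHk _ _ (Ck_pred fk) (Ck_deriv i gk))
                  (IHk _ _ (Ck_pred gk) (Ck_deriv i fk)).
apply: Ck_congr => // x Dx.
by apply/esym; apply: deriveM; [exact: fd|exact: gd].
Qed.

End Euclidean.

Variable X : manifold R.
Implicit Types U : set X.

Lemma chart_image_open U (c : chart R X (mdim X)) : open U ->
  open (chart_map c @` (U `&` chart_dom c)).
Proof.
move=> Uo; rewrite openE => _ [x [Ux cx] <-]; rewrite /interior.
have nU : nbhs (chart_inv c (chart_map c x)) (U `&` chart_dom c).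
  rewrite chart_mapK //; apply: open_nbhs_nbhs; split=> //.
  by apply: openI => //; exact: chart_dom_open.
have nI : nbhs (chart_map c x) (chart_map c @` chart_dom c).
  by apply: open_nbhs_nbhs; split; [exact: chart_im_open|exists x].
have nV := chart_inv_cont cx nU.
near=> y; have [z cz zy] : (chart_map c @` chart_dom c) y by near: y.
have : (U `&` chart_dom c) (chart_inv c y) by near: y.
by rewrite -zy chart_mapK // => Uz; exists z.
Unshelve. all: by end_near.
Qed.

Lemma smooth_on_congr U f g : open U -> (forall x, U x -> f x = g x) ->
  smooth_on U f -> smooth_on U g.
Proof.
move=> Uo fg fs c ca k; apply: Ck_congr (fs c ca k); first exact: chart_image_open.
by move=> _ [x [Ux cx] <-]; rewrite chart_mapK // fg.
Qed.

Lemma smooth_on_local U f :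
  (forall x, U x -> exists2 V : set X, V x & smooth_on V f) -> smooth_on U f.
Proof.
move=> H c ca k; apply: Ck_local => _ [x [Ux cx] <-]; have [V Vx fV] := H _ Ux.
by exists (chart_map c @` (V `&` chart_dom c)); [exists x|exact: fV].
Qed.

Lemma smooth_on_sub U V f : V `<=` U -> smooth_on U f -> smooth_on V f.
Proof.
move=> VU fs; apply: smooth_on_local => x Vx.
by exists U => //; exact: VU.
Qed.

Lemma smooth_on_cst U (a : R) : smooth_on U (fun=> a).
Proof. by move=> c _; exact: Cinfty_cst. Qed.

Lemma smooth_on_add U f g : open U -> smooth_on U f -> smooth_on U g ->
  smooth_on U (fun x => f x + g x).
Proof.
by move=> Uo fs gs c ca k; apply: Ck_add; [exact: chart_image_open|exact: fs|exact: gs].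
Qed.

Lemma smooth_on_mul U f g : open U -> smooth_on U f -> smooth_on U g ->
  smooth_on U (fun x => f x * g x).
Proof.
by move=> Uo fs gs c ca k; apply: Ck_mul; [exact: chart_image_open|exact: fs|exact: gs].
Qed.

Lemma smooth_on_opp U f : open U -> smooth_on U f -> smooth_on U (fun x => - f x).
Proof.
move=> Uo fs; have := smooth_on_mul Uo (smooth_on_cst U (-1)) fs.
by apply: smooth_on_congr => // x _; rewrite mulN1r.
Qed.

End SmoothFunctions.

Section SmoothVectors.
Variables (R : realType) (k : ground) (X : manifold R).
Notation K := (ground_field R k).
Implicit Types U : set X.

Definition smooth_scal U (f : X -> K) : Prop :=
  smooth_on U (fun x => ground_re (f x)) /\ smooth_on U (fun x => ground_im (f x)).

Lemma smooth_scal_cst U c : smooth_scal U (fun=> c).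
Proof. by split; exact: smooth_on_cst. Qed.

Lemma smooth_scal_add U f g : open U -> smooth_scal U f -> smooth_scal U g ->
  smooth_scal U (fun x => f x + g x).
Proof.
move=> Uo [f1 f2] [g1 g2]; split.
  apply: smooth_on_congr (smooth_on_add Uo f1 g1) => // x _.
  by case: k f g {f1 f2 g1 g2} => //= f g; case: (f x) (g x) => [? ?] [? ?].
apply: smooth_on_congr (smooth_on_add Uo f2 g2) => // x _.
case: k f g {f1 f2 g1 g2} => //= f g; first exact: addr0.
by case: (f x) (g x) => [? ?] [? ?].
Qed.

Lemma smooth_scal_mul U f g : open U -> smooth_scal U f -> smooth_scal U g ->
  smooth_scal U (fun x => f x * g x).
Proof.
move=> Uo [f1 f2] [g1 g2]; split.
  have := smooth_on_add Uo (smooth_on_mul Uo f1 g1)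
                           (smooth_on_opp Uo (smooth_on_mul Uo f2 g2)).
  apply: smooth_on_congr => // x _.
  case: k f g {f1 f2 g1 g2} => //= f g; first by rewrite mul0r subr0.
  by case: (f x) (g x) => [? ?] [? ?].
have := smooth_on_add Uo (smooth_on_mul Uo f1 g2) (smooth_on_mul Uo f2 g1).
apply: smooth_on_congr => // x _.
case: k f g {f1 f2 g1 g2} => //= f g; first by rewrite mul0r mulr0 addr0.
by case: (f x) (g x) => [? ?] [? ?].
Qed.

Lemma smooth_scal_congr U f g : open U -> (forall x, U x -> f x = g x) ->
  smooth_scal U f -> smooth_scal U g.
Proof.
move=> Uo fg [f1 f2]; split.
  by apply: smooth_on_congr f1 => // x /fg ->.
by apply: smooth_on_congr f2 => // x /fg ->.
Qed.

Lemma smooth_vec_congr (V : vectType K) U (f g : X -> V) : open U ->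
  (forall x, U x -> f x = g x) -> smooth_vec U f -> smooth_vec U g.
Proof.
move=> Uo fg fs i; apply: smooth_scal_congr (fs i) => // x Ux.
by rewrite fg.
Qed.

Lemma smooth_vec_sub (V : vectType K) U U' (f : X -> V) :
  U' `<=` U -> smooth_vec U f -> smooth_vec U' f.
Proof.
by move=> UU' fs i; have [f1 f2] := fs i; split; exact: smooth_on_sub UU' _.
Qed.

Lemma smooth_vec_local (V : vectType K) U (f : X -> V) :
  (forall x, U x -> exists2 U', U' x & smooth_vec U' f) -> smooth_vec U f.
Proof.
move=> H i; split; apply: smooth_on_local => x /H[U' U'x fs]; exists U' => //;
  by have [] := fs i.
Qed.

Lemma smooth_vec_cst (V : vectType K) U (v : V) : smooth_vec U (fun=> v).
Proof. by move=> i; exact: smooth_scal_cst. Qed.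

Lemma smooth_vec_add (V : vectType K) U (f g : X -> V) : open U ->
  smooth_vec U f -> smooth_vec U g -> smooth_vec U (fun x => f x + g x).
Proof.
move=> Uo fs gs i; apply: smooth_scal_congr (smooth_scal_add Uo (fs i) (gs i)) => //.
by move=> x _; rewrite linearD.
Qed.

Lemma smooth_vec_scale (V : vectType K) U (c : X -> K) (f : X -> V) : open U ->
  smooth_scal U c -> smooth_vec U f -> smooth_vec U (fun x => c x *: f x).
Proof.
move=> Uo cs fs i; apply: smooth_scal_congr (smooth_scal_mul Uo cs (fs i)) => //.
by move=> x _; rewrite linearZ.
Qed.

Lemma smooth_vec_sum (V : vectType K) U n (f : 'I_n -> X -> V) : open U ->
  (forall i, smooth_vec U (f i)) -> smooth_vec U (fun x => \sum_i f i x).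
Proof.
move=> Uo; elim: n f => [|n IHn] f fs.
  apply: smooth_vec_congr (smooth_vec_cst U 0) => // x _.
  by rewrite big_ord0.
have := smooth_vec_add Uo (IHn _ (fun i => fs (widen_ord (leqnSn n) i))) (fs ord_max).
by apply: smooth_vec_congr => // x _; rewrite big_ord_recr.
Qed.

(** Expand [f x] in a fixed basis of [V]. *)
Lemma smooth_vec_app (V W : vectType K) U (g : X -> 'Hom(V, W)) (f : X -> V) :
  open U -> (forall v, smooth_vec U (fun x => g x v)) -> smooth_vec U f ->
  smooth_vec U (fun x => g x (f x)).
Proof.
move=> Uo gs fs.
have := @smooth_vec_sum W U _ (fun i x => coord (vbasis fullv) i (f x) *: g x (vbasis fullv)`_i) Uo
  (fun i => smooth_vec_scale Uo (fs i) (gs _)).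
apply: smooth_vec_congr => // x _.
rewrite [in RHS](coord_vbasis (memvf (f x))) linear_sum.
by apply: eq_bigr => i _; rewrite linearZ.
Qed.

Lemma smooth_vec_lin (V W : vectType K) U (L : 'Hom(V, W)) (f : X -> V) :
  open U -> smooth_vec U f -> smooth_vec U (fun x => L (f x)).
Proof.
by move=> Uo fs; apply: (@smooth_vec_app _ _ _ (fun=> L)) => // v; exact: smooth_vec_cst.
Qed.

(** In [g x = sum_i g x e_i (x) e_i^*], each summand is the image of [g x e_i] under
    a fixed linear map. *)
Lemma smooth_vec_Hom (V W : vectType K) U (g : X -> 'Hom(V, W)) : open U ->
  (forall v, smooth_vec U (fun x => g x v)) -> smooth_vec U g.
Proof.
move=> Uo gs.
pose r (i : 'I_(\dim (fullv : {vspace V}))) : 'Hom(W, 'Hom(V, W)) :=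
  linfun (fun w => rank1 w (dual_basis i)).
have rE i w : r i w = rank1 w (dual_basis i).
  rewrite /r linfunP // => c u v; apply/lfunP => z.
  by rewrite add_lfunE scale_lfunE !rank1E scalerDr !scalerA mulrC.
have := @smooth_vec_sum _ U _ (fun i x => r i (g x (vbasis fullv)`_i)) Uo
  (fun i => smooth_vec_lin (r i) Uo (gs _)).
apply: smooth_vec_congr => // x _.
by rewrite [RHS]rank1_sum; apply: eq_bigr => i _; rewrite rE.
Qed.

End SmoothVectors.

(** * Vector bundles and bundles of linear maps *)

Section HomConj.
Variable K : fieldType.

(** The isomorphism of mapping spaces induced by isomorphisms of source and
    target. *)
Definition hom_conj (E F V W : vectType K) (t : 'Hom(E, V)) (s : 'Hom(F, W)) :
    'Hom('Hom(E, F), 'Hom(V, W)) :=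
  linfun (fun f => (s \o f \o t^-1)%VF).

Lemma hom_conjE (E F V W : vectType K) (t : 'Hom(E, V)) (s : 'Hom(F, W)) f v :
  hom_conj t s f v = s (f (t^-1%VF v)).
Proof.
rewrite /hom_conj linfunP ?comp_lfunE // => c g h.
by rewrite comp_lfunDr comp_lfunDl -comp_lfunZr -comp_lfunZl.
Qed.

Lemma hom_conj_bij (E F V W : vectType K) (t : 'Hom(E, V)) (s : 'Hom(F, W)) :
  bijective t -> bijective s -> bijective (hom_conj t s).
Proof.
move=> tb sb; exists (fun f => (s^-1 \o f \o t)%VF) => f; apply/lfunP => v.
  by rewrite !comp_lfunE hom_conjE !bij_lfunK.
by rewrite hom_conjE !comp_lfunE !bij_lfunVK.
Qed.

Lemma hom_conjV (E F V W : vectType K) (t : 'Hom(E, V)) (s : 'Hom(F, W)) f :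
  bijective t -> bijective s ->
  (hom_conj t s)^-1%VF f = (s^-1 \o f \o t)%VF.
Proof.
move=> tb sb; have hb := hom_conj_bij tb sb.
apply: (bij_inj hb); rewrite bij_lfunVK //; apply/lfunP => v.
by rewrite hom_conjE !comp_lfunE !bij_lfunVK.
Qed.

End HomConj.

Section VectorBundles.
Variables (R : realType) (k : ground) (X : manifold R).
Notation K := (ground_field R k).
Implicit Types (E F G : X -> vectType K) (U : set X).

(** A trivialization is compatible with the atlas when the changes of frame are
    smooth in both directions; this form drops the bundled record. *)
Lemma trivializationP E (vE : vbundle E) U (V : vectType K)
    (phi : forall x, 'Hom(E x, V)) :
  trivialization vE U phi <->
  [/\ open U, forall x, U x -> bijective (phi x) &
    forall t, vb_atlas vE t ->
      (forall v, smooth_vec (U `&` ltriv_dom t)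
        (fun x => phi x ((ltriv_map t x)^-1%VF v))) /\
      (forall v, smooth_vec (U `&` ltriv_dom t)
        (fun x => ltriv_map t x ((phi x)^-1%VF v)))].
Proof.
split=> [[Uo [phib H]]|[Uo phib H]].
  split=> // t ta; have [H1 H2] := H t ta.
  have UtO : open (U `&` ltriv_dom t) by apply: openI => //; exact: ltriv_open.
  split=> v.
    have H2v := H2 v; rewrite /= setIC in H2v.
    by apply: smooth_vec_congr H2v => // x _; rewrite id_lfunE.
  by have := H1 v; apply: smooth_vec_congr => // x _; rewrite id_lfunE.
exists Uo, phib => t /H[H1 H2].
have UtO : open (U `&` ltriv_dom t) by apply: openI => //; exact: ltriv_open.
split=> v.
  by have := H2 v; apply: smooth_vec_congr => // x _; rewrite id_lfunE.
rewrite /= setIC; apply: smooth_vec_congr (H1 v) => // x _.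
by rewrite id_lfunE.
Qed.

Lemma atlas_trivialization E (vE : vbundle E) t : vb_atlas vE t ->
  trivialization vE (ltriv_dom t) (ltriv_map t).
Proof.
move=> ta; exists (ltriv_open t), (ltriv_bij (l := t)) => s sa.
exact: (vb_compat ta sa).
Qed.

Lemma trivialization_sub E (vE : vbundle E) U U' (V : vectType K)
    (phi : forall x, 'Hom(E x, V)) : open U' -> U' `<=` U ->
  trivialization vE U phi -> trivialization vE U' phi.
Proof.
move=> U'o U'U /trivializationP[Uo phib H]; apply/trivializationP; split=> //.
  by move=> x /U'U /phib.
move=> t /H[H1 H2]; split=> v; [have := H1 v|have := H2 v];
  by apply: smooth_vec_sub => x [/U'U].
Qed.

(** Change of frame between two trivializations over the same open set: read
    both in an atlas chart near each point. *)
Lemma trivialization_change E (vE : vbundle E) U (V V' : vectType K)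
    (phi : forall x, 'Hom(E x, V)) (phi' : forall x, 'Hom(E x, V')) :
  trivialization vE U phi -> trivialization vE U phi' ->
  forall v, smooth_vec U (fun x => phi' x ((phi x)^-1%VF v)).
Proof.
move=> /trivializationP[Uo phib H] /trivializationP[_ phib' H'] v.
apply: smooth_vec_local => x Ux; have [t ta tx] := vb_cover vE x.
have UtO : open (U `&` ltriv_dom t) by apply: openI => //; exact: ltriv_open.
exists (U `&` ltriv_dom t) => //.
have := smooth_vec_app UtO (g := fun x => (phi' x \o (ltriv_map t x)^-1)%VF) _
  ((H t ta).2 v).
move=> /(_ _) S; apply: (smooth_vec_congr UtO _ (S _)) => [y [Uy ty]|w].
  by rewrite comp_lfunE bij_lfunK //; exact: ltriv_bij.
have := (H' t ta).1 w; apply: smooth_vec_congr => // y _.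
by rewrite comp_lfunE.
Qed.

Section HomBundle.
Variables (E F : X -> vectType K) (vE : vbundle E) (vF : vbundle F).

Fact hom_ltriv_open (t : ltriv E) (s : ltriv F) :
  open (ltriv_dom t `&` ltriv_dom s).
Proof. by apply: openI; exact: ltriv_open. Qed.

Fact hom_ltriv_bij (t : ltriv E) (s : ltriv F) x :
  (ltriv_dom t `&` ltriv_dom s) x ->
  bijective (hom_conj (ltriv_map t x) (ltriv_map s x)).
Proof. by move=> [tx sx]; apply: hom_conj_bij; exact: ltriv_bij. Qed.

Definition hom_ltriv (t : ltriv E) (s : ltriv F) :
    ltriv (fun x => 'Hom(E x, F x) : vectType K) :=
  LTriv (hom_ltriv_open t s) (@hom_ltriv_bij t s).

Lemma hom_conj_smooth U (V W V' W' : vectType K)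
    (phi : forall x, 'Hom(E x, V)) (psi : forall x, 'Hom(F x, W))
    (phi' : forall x, 'Hom(E x, V')) (psi' : forall x, 'Hom(F x, W')) :
  trivialization vE U phi -> trivialization vF U psi ->
  trivialization vE U phi' -> trivialization vF U psi' ->
  forall f : 'Hom(V, W), smooth_vec U (fun x =>
    hom_conj (phi' x) (psi' x) ((hom_conj (phi x) (psi x))^-1%VF f)).
Proof.
move=> phiT psiT phiT' psiT' f.
have [Uo phib _] := (trivializationP _ _ _).1 phiT.
have [_ psib _] := (trivializationP _ _ _).1 psiT.
apply: smooth_vec_Hom => // v.
have S1 := trivialization_change phiT' phiT v.
have S2 := smooth_vec_lin f Uo S1.
have S3 := smooth_vec_app Uo (g := fun x => (psi' x \o (psi x)^-1)%VF) _ S2.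
apply: (smooth_vec_congr Uo _ (S3 _)) => [y Uy|w].
  rewrite hom_conjE hom_conjV; [|exact: phib|exact: psib].
  by rewrite !comp_lfunE.
have := trivialization_change psiT psiT' w.
by apply: smooth_vec_congr => // y _; rewrite comp_lfunE.
Qed.

Definition hom_atlas (r : ltriv (fun x => 'Hom(E x, F x) : vectType K)) : Prop :=
  exists t s, [/\ vb_atlas vE t, vb_atlas vF s & r = hom_ltriv t s].

Fact hom_cover x : exists2 r, hom_atlas r & ltriv_dom r x.
Proof.
have [t ta tx] := vb_cover vE x; have [s sa sx] := vb_cover vF x.
by exists (hom_ltriv t s) => //; exists t, s.
Qed.

Fact hom_smooth_map_in t s t' s' : vb_atlas vE t -> vb_atlas vF s ->
  vb_atlas vE t' -> vb_atlas vF s' ->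
  smooth_map_in (hom_ltriv t s) (hom_ltriv t' s') (fun x => \1%VF).
Proof.
move=> ta sa ta' sa' f.
pose U := ltriv_dom (hom_ltriv t s) `&` ltriv_dom (hom_ltriv t' s').
have Uo : open U by apply: openI; exact: hom_ltriv_open.
have tT := trivialization_sub Uo _ (atlas_trivialization ta).
have sT := trivialization_sub Uo _ (atlas_trivialization sa).
have tT' := trivialization_sub Uo _ (atlas_trivialization ta').
have sT' := trivialization_sub Uo _ (atlas_trivialization sa').
have := hom_conj_smooth (tT _) (sT _) (tT' _) (sT' _) f.
move=> /(_ _ _ _ _) S; apply: (smooth_vec_congr Uo _ (S _ _ _ _)).
- by move=> x _; rewrite id_lfunE.
- by move=> x [[]].
- by move=> x [[]].
- by move=> x [_ []].
- by move=> x [_ []].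
Qed.

Fact hom_compat r r' : hom_atlas r -> hom_atlas r' -> ltriv_compat r r'.
Proof.
move=> [t [s [ta sa ->]]] [t' [s' [ta' sa' ->]]].
by split; exact: hom_smooth_map_in.
Qed.

Definition hom_vb : vbundle (fun x => 'Hom(E x, F x) : vectType K) :=
  VBundle hom_cover hom_compat.

Lemma hom_trivialization U (V W : vectType K)
    (phi : forall x, 'Hom(E x, V)) (psi : forall x, 'Hom(F x, W)) :
  trivialization vE U phi -> trivialization vF U psi ->
  trivialization hom_vb U (fun x => hom_conj (phi x) (psi x)).
Proof.
move=> phiT psiT; apply/trivializationP.
have [Uo phib _] := (trivializationP _ _ _).1 phiT.
have [_ psib _] := (trivializationP _ _ _).1 psiT.
split=> // [x Ux|_ [t [s [ta sa ->]]]].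
  by apply: hom_conj_bij; [exact: phib|exact: psib].
pose D := U `&` ltriv_dom (hom_ltriv t s).
have Do : open D by apply: openI => //; exact: hom_ltriv_open.
have DU : D `<=` U by move=> x [].
have Dt : D `<=` ltriv_dom t by move=> x [_ []].
have Ds : D `<=` ltriv_dom s by move=> x [_ []].
have phiD := trivialization_sub Do DU phiT.
have psiD := trivialization_sub Do DU psiT.
have tD := trivialization_sub Do Dt (atlas_trivialization ta).
have sD := trivialization_sub Do Ds (atlas_trivialization sa).
by split; [exact: hom_conj_smooth tD sD phiD psiD|exact: hom_conj_smooth phiD psiD tD sD].
Qed.

End HomBundle.

(** Structure maps of bundles of algebras and bimodules are constant in suitable
    trivializations [phi], [psi], [chi].  In arbitrary charts [t], [s], [r] the map
    reads [(r chi^-1) (b0 (phi t^-1 v) (psi s^-1 w))], with smooth changes of frame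
    around the constant [b0]. *)
Lemma smooth_bilin_local E F G (vE : vbundle E) (vF : vbundle F) (vG : vbundle G)
    (b : forall x, 'Hom(E x, 'Hom(F x, G x))) :
  (forall x, exists (U : set X) (V W Z : vectType K) (phi : forall y, 'Hom(E y, V))
      (psi : forall y, 'Hom(F y, W)) (chi : forall y, 'Hom(G y, Z))
      (b0 : 'Hom(V, 'Hom(W, Z))),
    [/\ U x, trivialization vE U phi, trivialization vF U psi,
        trivialization vG U chi
      & forall y, U y -> forall e f, chi y (b y e f) = b0 (phi y e) (psi y f)]) ->
  smooth_bilin vE vF vG b.
Proof.
move=> H t s r ta sa ra v w; apply: smooth_vec_local => x [[tx sx] rx].
have [U [V [W [Z [phi [psi [chi [b0 [Ux phiT psiT chiT bE]]]]]]]]] := H x.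
have [Uo phib _] := (trivializationP _ _ _).1 phiT.
have [_ chib _] := (trivializationP _ _ _).1 chiT.
pose D := U `&` (ltriv_dom t `&` ltriv_dom s `&` ltriv_dom r).
have Do : open D.
  by apply: openI => //; apply: openI; [apply: openI|]; exact: ltriv_open.
have DU : D `<=` U by move=> y [].
have Dt : D `<=` ltriv_dom t by move=> y [_ [[]]].
have Ds : D `<=` ltriv_dom s by move=> y [_ [[]]].
have Dr : D `<=` ltriv_dom r by move=> y [_ []].
exists D; first by split.
have S1 := trivialization_change (trivialization_sub Do Dt (atlas_trivialization ta))
  (trivialization_sub Do DU phiT) v.
have S2 := trivialization_change (trivialization_sub Do Ds (atlas_trivialization sa))
  (trivialization_sub Do DU psiT) w.
have S3 := smooth_vec_lin b0 Do S1.
have ev_smooth z : smooth_vec D (fun y => b0 (phi y ((ltriv_map t y)^-1%VF v)) z).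
  pose ev : 'Hom('Hom(W, Z), Z) := linfun (fun f : 'Hom(W, Z) => f z).
  have evE f : ev f = f z.
    by rewrite /ev linfunP // => c g h; rewrite add_lfunE scale_lfunE.
  by have := smooth_vec_lin ev Do S3; apply: smooth_vec_congr => // y _; rewrite evE.
have S4 := smooth_vec_app Do ev_smooth S2.
have r_smooth z : smooth_vec D (fun y => (ltriv_map r y \o (chi y)^-1)%VF z).
  have := trivialization_change (trivialization_sub Do DU chiT)
    (trivialization_sub Do Dr (atlas_trivialization ra)) z.
  by apply: smooth_vec_congr => // y _; rewrite comp_lfunE.
have := smooth_vec_app Do r_smooth S4.
apply: smooth_vec_congr => // y [Uy _].
by rewrite comp_lfunE -bE // bij_lfunK //; exact: chib.
Qed.

Lemma trivial_trivialization (A0 : salg K) U : open U ->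
  trivialization (trivial_vb X A0) U (fun=> \1%VF : 'End(A0)).
Proof.
move=> Uo; have := @trivialization_sub _ (trivial_vb X A0) setT U _ (fun=> \1%VF).
by apply => //; exact: (@atlas_trivialization _ (trivial_vb X A0) (trivial_ltriv X A0)).
Qed.

Lemma smooth_map_id E (vE : vbundle E) : smooth_map vE vE (fun x => \1%VF).
Proof. by move=> t s ta sa; have [] := vb_compat ta sa. Qed.

End VectorBundles.

(** * Bundles of algebras and Morita bimodules *)

Section LocalModels.
Variable K : numFieldType.
Implicit Types A B : salg K.

Lemma salg_hom_op A B (phi : 'Hom(A, B)) : salg_hom phi ->
  forall a b, phi (op_mul A a b) = op_mul B (phi a) (phi b).
Proof.
move=> [phie _ phiM] a b.
elim/homogeneous_ind: b => [u v IHu IHv|j b bj].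
  by rewrite bilDr !linearD /= IHu IHv.
elim/homogeneous_ind: a => [u v IHu IHv|i a ai].
  by rewrite bilDl !linearD /= add_lfunE IHu IHv.
rewrite (op_mulE _ bj) (op_mulE _ (phie _ _ bj)) phiM; congr (smul B _ _).
by rewrite (twE _ ai) (twE _ (phie _ _ ai)) linearZ.
Qed.

Lemma salg_hom_two_sided A B (phi : 'Hom(A, B)) : salg_hom phi -> bijective phi ->
  forall a b, hom_conj phi phi (two_sided A a b) = two_sided B (phi a) (phi b).
Proof.
move=> [phie _ phiM] phib a b; apply/lfunP => v; rewrite hom_conjE.
elim/homogeneous_ind: b => [b b' IHb IHb'|j b bj].
  by rewrite bilDr linearD add_lfunE linearD /= IHb IHb' bilDr add_lfunE.
rewrite (two_sidedE _ _ bj) (two_sidedE _ _ (phie _ _ bj)) !phiM.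
congr (smul B (smul B _ _) _).
rewrite -{2}(bij_lfunVK phib v); set w := phi^-1%VF v.
elim/homogeneous_ind: w => [u u' IHu IHu'|i u ui]; first by rewrite !linearD /= IHu IHu'.
by rewrite (twE _ ui) (twE _ (phie _ _ ui)) linearZ.
Qed.

Lemma hom_conj_even (E F V W : svect K) (t : 'Hom(E, V)) (s : 'Hom(F, W)) :
  even_map t -> even_map s -> bijective t ->
  @even_map K (hom_svect E F) (hom_svect V W) (hom_conj t s).
Proof.
move=> te se tb i f /hom_partP fi; apply/hom_partP => j v vj; rewrite hom_conjE.
apply/se/fi/(even_inverse te tb).
by rewrite bij_lfunVK.
Qed.

Lemma End_conj_hom (V W : svect K) (t : 'Hom(V, W)) : even_map t -> bijective t ->
  @salg_hom K (End_salg V) (End_salg W) (hom_conj t t).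
Proof.
move=> te tb; split; first exact: hom_conj_even.
  by apply/lfunP => v; rewrite hom_conjE !id_lfunE bij_lfunVK.
move=> f g; rewrite /= !End_mulE; apply/lfunP => v.
by rewrite hom_conjE !comp_lfunE !hom_conjE bij_lfunK.
Qed.

Lemma id_even (V : svect K) : even_map (\1%VF : 'End(V)).
Proof. by move=> i v; rewrite id_lfunE. Qed.

Lemma id_bij (V : vectType K) : bijective (\1%VF : 'End(V)).
Proof. by exists id => v; rewrite id_lfunE. Qed.

Lemma id_salg_hom A : salg_hom (\1%VF : 'End(A)).
Proof. by split=> [||a b]; rewrite ?id_lfunE //; exact: id_even. Qed.

Lemma hom_conj_rank1 (E V : vectType K) (t : 'Hom(E, V)) e (f : 'Hom(E, K^o)) :
  hom_conj t t (rank1 e f) = rank1 (t e) (hom_conj t (\1%VF : 'End(K^o)) f).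
Proof.
apply/lfunP => v; rewrite hom_conjE !rank1E hom_conjE linearZ /=.
by rewrite id_lfunE.
Qed.

End LocalModels.

Section AlgebraBundles.
Variables (R : realType) (k : ground) (X : manifold R).
Notation K := (ground_field R k).
Notation ground_bdl := (trivial_salgbdl X (ground_salg K)).
Implicit Types A B : salgbdl k X.

Lemma salg_loc_bij A U (A0 : salg K) (phi : forall y, 'Hom(A y, A0)) :
  salg_trivialization (salg_vb A) U phi -> forall y, U y -> bijective (phi y).
Proof. by move=> [/trivializationP[]]. Qed.

Fact op_loc A : @salg_locally_trivial R k X (fun x => op_salg (A x)) (salg_vb A).
Proof.
move=> x; have [U [A0 [phi [Ux [phiT phiH]]]]] := salg_loc A x.
exists U, (op_salg A0), phi; split=> //; split=> // y Uy.
have [phie phi1 phiM] := phiH y Uy; split=> // a b.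
exact: (salg_hom_op (phiH y Uy)).
Qed.

Definition op_bdl A : salgbdl k X := SAlgBdl (@op_loc A).

Lemma End_trivialization A U (A0 : salg K) (phi : forall y, 'Hom(A y, A0)) :
  salg_trivialization (salg_vb A) U phi ->
  @salg_trivialization R k X (fun x => End_salg (A x)) (hom_vb (salg_vb A) (salg_vb A))
    U (End_salg A0) (fun y => hom_conj (phi y) (phi y)).
Proof.
move=> phiT; have phib := salg_loc_bij phiT; have [phiV phiH] := phiT.
split; first exact: hom_trivialization.
move=> y Uy; have [phie _ _] := phiH y Uy.
by apply: End_conj_hom => //; exact: phib.
Qed.

Fact End_loc A : @salg_locally_trivial R k X (fun x => End_salg (A x))
  (hom_vb (salg_vb A) (salg_vb A)).
Proof.
move=> x; have [U [A0 [phi [Ux phiT]]]] := salg_loc A x.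
exists U, (End_salg A0), (fun y => hom_conj (phi y) (phi y)).
by split=> //; exact: End_trivialization.
Qed.

Definition End_bdl A : salgbdl k X := SAlgBdl (@End_loc A).

Lemma ground_trivialization U : open U ->
  @salg_trivialization R k X _ (salg_vb ground_bdl) U (ground_salg K) (fun=> \1%VF).
Proof.
move=> Uo; split; first exact: trivial_trivialization.
by move=> y _; exact: id_salg_hom.
Qed.

Fact std_loc A : @sbimod_locally_trivial R k X (End_bdl A) ground_bdl
  (fun x => std_bimod (A x)) (salg_vb A).
Proof.
move=> x; have [U [A0 [phi [Ux phiT]]]] := salg_loc A x.
have phib := salg_loc_bij phiT; have [phiV phiH] := phiT.
have [Uo _ _] := (trivializationP _ _ _).1 phiV.
exists U, (End_salg A0), (ground_salg K), (std_bimod A0),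
  (fun y => hom_conj (phi y) (phi y)), (fun=> \1%VF), phi; split=> //.
- exact: End_trivialization.
- exact: ground_trivialization.
move=> y Uy; have [phie _ _] := phiH y Uy; split=> // f m c.
rewrite !ract_ground linearZ /= id_lfunE; congr (_ *: _).
by rewrite !id_lfunE hom_conjE bij_lfunK //; exact: phib.
Qed.

Definition std_bdl A : sbimodbdl (End_bdl A) ground_bdl := SBimodBdl (@std_loc A).

Lemma dual_trivialization A U (A0 : salg K) (phi : forall y, 'Hom(A y, A0)) :
  salg_trivialization (salg_vb A) U phi ->
  trivialization (hom_vb (salg_vb A) (salg_vb ground_bdl)) U
    (fun y => hom_conj (phi y) (\1%VF : 'End(ground_salg K))).
Proof.
move=> [phiV _]; have [Uo _ _] := (trivializationP _ _ _).1 phiV.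
by apply: hom_trivialization => //; exact: trivial_trivialization.
Qed.

Fact dual_loc A : @sbimod_locally_trivial R k X ground_bdl (End_bdl A)
  (fun x => dual_bimod (A x)) (hom_vb (salg_vb A) (salg_vb ground_bdl)).
Proof.
move=> x; have [U [A0 [phi [Ux phiT]]]] := salg_loc A x.
have phib := salg_loc_bij phiT; have [phiV phiH] := phiT.
have [Uo _ _] := (trivializationP _ _ _).1 phiV.
exists U, (ground_salg K), (End_salg A0), (dual_bimod A0), (fun=> \1%VF),
  (fun y => hom_conj (phi y) (phi y)),
  (fun y => hom_conj (phi y) (\1%VF : 'End(ground_salg K))); split=> //.
- exact: ground_trivialization.
- exact: End_trivialization.
- exact: dual_trivialization.
move=> y Uy; have [phie _ _] := phiH y Uy; split.
  by apply: hom_conj_even; [|exact: id_even|exact: phib].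
move=> c m f; rewrite !lact_ground id_lfunE /= !dual_actE -!comp_lfunZl linearZ /=.
congr (_ *: _); apply/lfunP => v.
by rewrite hom_conjE !comp_lfunE !hom_conjE bij_lfunK //; exact: phib.
Qed.

Definition dual_bdl A : sbimodbdl ground_bdl (End_bdl A) := SBimodBdl (@dual_loc A).

Lemma two_sided_bdl_tensor A : fibrewise_central_simple A ->
  bdl_graded_tensor A (op_bdl A) (End_bdl A).
Proof.
move=> Acs; exists (fun x => two_sided (A x)); split; last first.
  by move=> x; exact: two_sided_tensor.
apply: smooth_bilin_local => x; have [U [A0 [phi [Ux phiT]]]] := salg_loc A x.
have phib := salg_loc_bij phiT; have [phiV phiH] := phiT.
exists U, A0, A0, (End_salg A0), phi, phi, (fun y => hom_conj (phi y) (phi y)),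
  (two_sided A0); split=> //; first exact: hom_trivialization.
by move=> y Uy a b; apply: salg_hom_two_sided; [exact: phiH|exact: phib].
Qed.

Lemma std_dual_bdl_tensor A :
  bdl_rel_tensor (std_bdl A) (dual_bdl A) (regular_bdl (End_bdl A)).
Proof.
exists (fun x => std_dual_tensor (A x)); split; last first.
  by move=> x; exact: std_dual_rel_tensor.
apply: smooth_bilin_local => x; have [U [A0 [phi [Ux phiT]]]] := salg_loc A x.
have [phiV _] := phiT.
exists U, A0, (dual_svect A0), (End_salg A0), phi,
  (fun y => hom_conj (phi y) (\1%VF : 'End(ground_salg K))),
  (fun y => hom_conj (phi y) (phi y)), (std_dual_tensor A0); split=> //.
- exact: dual_trivialization.
- exact: hom_trivialization.
by move=> y Uy e f; rewrite !std_dual_tensorE; exact: hom_conj_rank1.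
Qed.

Lemma dual_std_bdl_tensor A : (forall x, sone (A x) <> 0) ->
  bdl_rel_tensor (dual_bdl A) (std_bdl A) (regular_bdl ground_bdl).
Proof.
move=> A1; exists (fun x => dual_std_tensor (A x)); split; last first.
  move=> x; apply: dual_std_rel_tensor.
  by exists (sone (A x)); apply/eqP; exact: A1.
apply: smooth_bilin_local => x; have [U [A0 [phi [Ux phiT]]]] := salg_loc A x.
have phib := salg_loc_bij phiT; have [phiV _] := phiT.
have [Uo _ _] := (trivializationP _ _ _).1 phiV.
exists U, (dual_svect A0), A0, (ground_salg K),
  (fun y => hom_conj (phi y) (\1%VF : 'End(ground_salg K))), phi,
  (fun=> \1%VF), (dual_std_tensor A0); split=> //.
- exact: dual_trivialization.
- exact: trivial_trivialization.
move=> y Uy e f; rewrite !dual_std_tensorE hom_conjE.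
by rewrite bij_lfunK //; exact: phib.
Qed.

Lemma regular_bdl_tensor A :
  bdl_rel_tensor (regular_bdl A) (regular_bdl A) (regular_bdl A).
Proof.
exists (fun x => smul (A x)); split; last by move=> x; exact: regular_rel_tensor.
apply: smooth_bilin_local => x; have [U [A0 [phi [Ux phiT]]]] := salg_loc A x.
have [phiV phiH] := phiT.
exists U, A0, A0, A0, phi, phi, phi, (smul A0); split=> // y Uy a b.
by have [_ _] := phiH y Uy; apply.
Qed.

Lemma id_bdl_intertwiner A B (M : sbimodbdl A B) :
  bdl_intertwiner (M := M) (N := M) (fun x => \1%VF).
Proof.
split=> [|x]; first exact: smooth_map_id.
by split=> [i v|a m|m b]; rewrite !id_lfunE.
Qed.

End AlgebraBundles.

(** * Invertibility in the bicategories *)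

Section Bicategories.
Variables (R : realType) (k : ground) (X : manifold R).
Notation K := (ground_field R k).
Notation ground_bdl := (trivial_salgbdl X (ground_salg K)).
Implicit Types (A B : salgbdl k X) (C : bicat k X).

Lemma isomorphic1_refl C A B (M : sbimodbdl A B) :
  mor2 C (fun x => \1%VF : 'End(M x)) -> isomorphic1 C M M.
Proof.
move=> m2; exists (fun x => \1%VF); split=> //; exists (fun x => \1%VF).
by split=> // x; rewrite comp_lfun1l.
Qed.

Lemma isomorphic1_sAlgBdl A B (M : sbimodbdl A B) : isomorphic1 (sAlgBdl k X) M M.
Proof. exact/isomorphic1_refl/id_bdl_intertwiner. Qed.

Lemma isomorphic1_Grpd A B (M : sbimodbdl A B) :
  isomorphic1 (Grpd (sAlgBdl k X)) M M.
Proof.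
apply: isomorphic1_refl; split; first exact: id_bdl_intertwiner.
exists (fun x => \1%VF); split; first exact: id_bdl_intertwiner.
by move=> x; rewrite comp_lfun1l.
Qed.

Lemma regular_bdl_implementing A : implementing (regular_bdl A).
Proof. by move=> x; exact: regular_implementing. Qed.

Lemma regular_bdl_invertible A : invertible1 (sAlgBdl k X) (regular_bdl A).
Proof.
exists (regular_bdl A); split; first exact: regular_bdl_implementing.
  exists (regular_bdl A); split; [exact: regular_bdl_implementing
    |exact: regular_bdl_tensor|exact: isomorphic1_sAlgBdl].
exists (regular_bdl A); split; [exact: regular_bdl_implementing
  |exact: regular_bdl_tensor|exact: isomorphic1_sAlgBdl].
Qed.

Section Morita.
Variable A : salgbdl k X.
Hypothesis A_neq0 : forall x, sone (A x) <> 0.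

Lemma std_bdl_implementing : implementing (std_bdl A).
Proof.
by move=> x; apply: (std_implementing (sone_even (A x))); apply/eqP; exact: A_neq0.
Qed.

Lemma dual_bdl_implementing : implementing (dual_bdl A).
Proof.
by move=> x; apply: (dual_implementing (sone_even (A x))); apply/eqP; exact: A_neq0.
Qed.

Lemma std_bdl_invertible : invertible1 (sAlgBdl k X) (std_bdl A).
Proof.
exists (dual_bdl A); split; first exact: dual_bdl_implementing.
  exists (regular_bdl (End_bdl A)); split; [exact: regular_bdl_implementing
    |exact: std_dual_bdl_tensor|exact: isomorphic1_sAlgBdl].
exists (regular_bdl ground_bdl); split; [exact: regular_bdl_implementing
  |exact: dual_std_bdl_tensor|exact: isomorphic1_sAlgBdl].
Qed.

Lemma dual_bdl_invertible : invertible1 (sAlgBdl k X) (dual_bdl A).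
Proof.
exists (std_bdl A); split; first exact: std_bdl_implementing.
  exists (regular_bdl ground_bdl); split; [exact: regular_bdl_implementing
    |exact: dual_std_bdl_tensor|exact: isomorphic1_sAlgBdl].
exists (regular_bdl (End_bdl A)); split; [exact: regular_bdl_implementing
  |exact: std_dual_bdl_tensor|exact: isomorphic1_sAlgBdl].
Qed.

Lemma End_bdl_equivalent : equivalent (sAlgBdl k X) (End_bdl A) ground_bdl.
Proof.
by exists (std_bdl A); split; [exact: std_bdl_implementing|exact: std_bdl_invertible].
Qed.

(** In the bigroupoid, the inverse bimodule bundle and the regular ones that
    receive the two composites have to be invertible too. *)
Lemma End_bdl_equivalent_Grpd :
  equivalent (Grpd (sAlgBdl k X)) (End_bdl A) ground_bdl.
Proof.
have regM B : mor1 (Grpd (sAlgBdl k X)) (regular_bdl B).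
  by split; [exact: regular_bdl_implementing|exact: regular_bdl_invertible].
exists (std_bdl A); split.
  by split; [exact: std_bdl_implementing|exact: std_bdl_invertible].
exists (dual_bdl A); split.
- by split; [exact: dual_bdl_implementing|exact: dual_bdl_invertible].
- exists (regular_bdl (End_bdl A)); split; [exact: regM
    |exact: std_dual_bdl_tensor|exact: isomorphic1_Grpd].
- exists (regular_bdl ground_bdl); split; [exact: regM
    |exact: dual_std_bdl_tensor|exact: isomorphic1_Grpd].
Qed.

End Morita.

Lemma isomorphic1_fibre C A B (M N : sbimodbdl A B) :
  (forall f : (forall x, 'Hom(M x, N x)), mor2 C f -> bdl_intertwiner f) ->
  isomorphic1 C M N -> forall x, sbimod_iso (M x) (N x).
Proof.
move=> C2 [f [/C2[_ fI] [g [_ gf]]]] x; exists (f x); split; first exact: fI.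
have [gfx fgx] := gf x.
by exists (g x) => v; rewrite -comp_lfunE ?gfx ?fgx id_lfunE.
Qed.

(** Tensor products and isomorphisms of bundles are defined fibre by fibre, so all
    the data restrict to a point. *)
Lemma invertible_ob_fibrewise C A :
  (forall B D (M N : sbimodbdl B D) (f : forall x, 'Hom(M x, N x)),
    mor2 C f -> bdl_intertwiner f) ->
  invertible_ob C A -> fibrewise_invertible A.
Proof.
move=> C2 [A' [T [_ _ [t [_ tT]] [M [_ [N [_ [P [_ [s [_ sT]] PI]]
  [Q [_ [r [_ rT]] QI]]]]]]]]] x.
exists (A' x), (T x), (t x); split; first exact: tT.
exists (M x), (N x); split.
  exists (P x), (s x); split; first exact: sT.
  exact: (isomorphic1_fibre (@C2 _ _ _ _) PI x).
exists (Q x), (r x); split; first exact: rT.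
exact: (isomorphic1_fibre (@C2 _ _ _ _) QI x).
Qed.

Lemma fibrewise_invertible_central_simple A :
  fibrewise_invertible A <-> fibrewise_central_simple A.
Proof.
split=> H x; first exact: (invertible_central_simple (H x)).
exact: central_simple_invertible.
Qed.

End Bicategories.

Theorem proposition4p4p3 (R : realType) (k : ground) (X : manifold R)
    (A : salgbdl k X) :
  (ob (Grpd (sAlgBdl k X)) A ->
    (invertible_ob (Grpd (sAlgBdl k X)) A <-> fibrewise_invertible A)) /\
  (ob (ss_sAlgBdl k X) A ->
    (invertible_ob (ss_sAlgBdl k X) A <-> fibrewise_invertible A)) /\
  (fibrewise_invertible A <-> fibrewise_central_simple A).
Proof.
have cs := fibrewise_invertible_central_simple A.
have A1 : fibrewise_central_simple A -> forall x, sone (A x) <> 0.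
  by move=> Acs x; exact: (Acs x).2.1.
split; [move=> _|split; [move=> _|exact: cs]]; split.
- by apply: invertible_ob_fibrewise => B D M N f [].
- move=> /cs Acs; exists (op_bdl A), (End_bdl A); split=> //.
    exact: two_sided_bdl_tensor.
  exact/End_bdl_equivalent_Grpd/A1.
- by apply: invertible_ob_fibrewise.
move=> /cs Acs; exists (op_bdl A), (End_bdl A); split.
- split=> // x; apply: simple_semisimple; apply: op_salg_simple; exact: (Acs x).2.
- split=> // x; apply: simple_semisimple; apply: End_salg_simple.
  by exists (sone (A x)); apply/eqP; exact: A1.
- exact: two_sided_bdl_tensor.
exact: (End_bdl_equivalent (A1 Acs)).
Qed.
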